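(* Assume that the following (conjectural) formulas hold for all integers $m\ge0$ and all $T\in[-1,1]$: if $N=2m$, $$\frac{1}{D_N} \int_{\Omega_N} |P(T)|\,dV = \frac{1}{2^{2m} \binom{2m}{m}} \left( \sum_{k=0}^{m} \frac{2m-2k+1}{2m+1} \binom{2m-2k}{m-k} \binom{2k}{k} T^{2k} \right) \left( \sum_{k=0}^{m} \binom{2m-2k}{m-k} \binom{2k}{k} T^{2k} \right),$$ and if $N=2m+1$, $$\frac{1}{D_N} \int_{\Omega_N} |P(T)|\,dV = \frac{1}{2^{2m+2} \binom{2m}{m}} \left( \sum_{k=0}^{m} \frac{2m-2k+1}{2m+1} \binom{2m-2k}{m-k} \binom{2k}{k} T^{2k} \right) \left( \sum_{k=0}^{m+1} \binom{2m+2-2k}{m+1-k} \binom{2k}{k} T^{2k} \right).$$ Then for every fixed interval $[a,b]$ with $-1<a<b<1$, the expected number of (real) zeros in $[a,b]$ of a random polynomial in $\Omega_N$ converges, as $N\to\infty$, to $$\frac{1}{\pi} \int^{b}_{a} \frac{dT}{1 - T^2} = \frac{1}{2 \pi} \log \left|\frac{(1-a)(1+b)}{(1+a)(1-b)}\right|.$$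
   Context: Identify a monic real polynomial $P(x)=x^N+a_1x^{N-1}+\cdots+a_N$ with $(a_1,\dots,a_N)\in\mathbf{R}^N$; $\Omega_N\subset\mathbf{R}^N$ is the region of monic real polynomials of degree $N$ all of whose complex roots have absolute value at most $1$ ($\Omega_0$ is a point of mass $1$, with $P=1$), $dV$ is Lebesgue measure and $D_N=\mathrm{Vol}(\Omega_N)=\int_{\Omega_N}dV$. A random polynomial is chosen according to normalized Lebesgue measure on $\Omega_N$. *)

(* Defs.v *)
From HB Require Import structures.
From mathcomp Require Import all_boot all_order all_algebra.
From mathcomp Require Import finmap.
From mathcomp Require Import complex.
From mathcomp Require Import all_classical all_reals all_analysis.

Set Implicit Arguments.
Unset Strict Implicit.
Unset Printing Implicit Defensive.

Import Order.TTheory GRing.Theory Num.Theory.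
Import numFieldNormedType.Exports.

Local Open Scope classical_set_scope.
Local Open Scope ring_scope.

(* [measurableTypeR R] is [R] itself; the name fixes the Borel structure from
   which the product sigma-algebra on tuples is built. *)
Notation coeffs R N := (N.-tuple (measurableTypeR R)).

Section lebesgue_tuple.
Variable R : realType.

Definition tuple_cons N (p : measurableTypeR R * coeffs R N) : coeffs R N.+1 :=
  [tuple of p.1 :: p.2].

(* N-dimensional Lebesgue measure, one coordinate at a time; in dimension 0 it
   is the unit mass at the empty tuple. *)
Fixpoint lebesgue_tuple (N : nat) : set (coeffs R N) -> \bar R :=
  if N is N'.+1
  then pushforward (lebesgue_measure \x @lebesgue_tuple N')%E (@tuple_cons N')
  else \d_([tuple] : coeffs R 0).

Lemma measurable_tuple_cons N : measurable_fun [set: _] (@tuple_cons N).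
Proof. exact: measurable_cons. Qed.

Let tuple_split N (t : coeffs R N.+1) : measurableTypeR R * coeffs R N :=
  (thead t, [tuple of behead t]).

Let tuple_splitK N : cancel (@tuple_split N) (@tuple_cons N).
Proof. by move=> t; rewrite /tuple_cons/= -tuple_eta. Qed.

Let tuple_consK N : cancel (@tuple_cons N) (@tuple_split N).
Proof. by move=> [x t]; congr pair; apply/val_inj. Qed.

Let measurable_tuple_split N : measurable_fun [set: _] (@tuple_split N).
Proof.
apply: measurable_fun_pair; first exact: measurable_tnth.
exact: measurable_behead.
Qed.

Section step.
Variables (N : nat) (mu : {sigma_finite_measure set (coeffs R N) -> \bar R}).

Let nu := pushforward (lebesgue_measure \x mu)%E (@tuple_cons N).

Let nu0 : nu set0 = 0%E.
Proof. by rewrite /nu /pushforward preimage_set0 measure0. Qed.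

Let nu_ge0 A : (0 <= nu A)%E.
Proof. by rewrite /nu /pushforward measure_ge0. Qed.

Let nu_sigma_additive : semi_sigma_additive nu.
Proof.
exact: (@measure_semi_sigma_additive _ _ _
  (measure_function_pushforward__canonical__measure_function_Measure
     _ (@measurable_tuple_cons N))).
Qed.

HB.instance Definition _ := isMeasure.Build _ _ _ nu
  nu0 nu_ge0 nu_sigma_additive.

Let nu_sigma_finite : sigma_finite setT nu.
Proof.
have /sigma_finiteP[F [TF ndF Foo]] :=
  sigma_finiteT (@lebesgue_measure R : {sigma_finite_measure set _ -> \bar R}).
have /sigma_finiteP[G [TG ndG Goo]] := sigma_finiteT mu.
exists (fun n => @tuple_split N @^-1` (F n `*` G n)).
  rewrite -preimage_bigcup (_ : \bigcup_i _ = setT) ?preimage_setT//.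
  rewrite -setXTT TF TG; apply/seteqP; split=> -[x y].
    by move=> [n _ []/= ? ?]; split; exists n.
  move=> [/= [n _ Fnx] [k _ Gky]]; exists (maxn n k) => //; split.
  - by move: x Fnx; exact/subsetPset/ndF/leq_maxl.
  - by move: y Gky; exact/subsetPset/ndG/leq_maxr.
move=> n; have [mF Fn] := Foo n; have [mG Gn] := Goo n.
split; first rewrite -[X in measurable X]setTI.
  by apply: measurable_tuple_split => //; exact: measurableX.
rewrite /nu /pushforward -comp_preimage (_ : _ \o _ = id) ?preimage_id.
  by rewrite product_measure1E// lte_mul_pinfty// ge0_fin_numE.
by apply/funext => p /=; rewrite tuple_consK.
Qed.

HB.instance Definition _ := Measure_isSigmaFinite.Build _ _ _ nu
  nu_sigma_finite.

Lemma lebesgue_tuple_step :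
  exists m : {sigma_finite_measure set (coeffs R N.+1) -> \bar R},
    m = nu :> (_ -> _).
Proof. by exists nu. Qed.

End step.

Lemma lebesgue_tuple_spec N :
  exists m : {sigma_finite_measure set (coeffs R N) -> \bar R},
    m = @lebesgue_tuple N :> (_ -> _).
Proof.
elim: N => [|N [mu /= <-]]; first by exists (dirac ([tuple] : coeffs R 0)).
exact: lebesgue_tuple_step.
Qed.

Section instances.
Variable N : nat.
Let mu := @lebesgue_tuple N.

Let mu0 : mu set0 = 0%E.
Proof. by rewrite /mu; have [m <-] := lebesgue_tuple_spec N; rewrite measure0. Qed.

Let mu_ge0 A : (0 <= mu A)%E.
Proof. by rewrite /mu; have [m <-] := lebesgue_tuple_spec N; rewrite measure_ge0. Qed.

Let mu_sigma_additive : semi_sigma_additive mu.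
Proof.
rewrite /mu; have [m <-] := lebesgue_tuple_spec N.
exact: measure_semi_sigma_additive.
Qed.

HB.instance Definition _ := isMeasure.Build _ _ _ (@lebesgue_tuple N)
  mu0 mu_ge0 mu_sigma_additive.

Let mu_sigma_finite : sigma_finite setT mu.
Proof. by rewrite /mu; have [m <-] := lebesgue_tuple_spec N; exact: (sigma_finiteT m). Qed.

HB.instance Definition _ := Measure_isSigmaFinite.Build _ _ _
  (@lebesgue_tuple N) mu_sigma_finite.

End instances.

Lemma lebesgue_tuple_box N (A : 'I_N -> set (measurableTypeR R)) :
  (forall i, measurable (A i)) ->
  lebesgue_tuple [set t : coeffs R N | forall i, A i (tnth t i)]
  = (\prod_(i < N) lebesgue_measure (A i))%E.
Proof.
elim: N A => [|N IH] A mA /=.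
  by rewrite big_ord0 diracE mem_set// => -[].
have mB : measurable
    [set t : coeffs R N | forall i, A (lift ord0 i) (tnth t i)].
  rewrite (_ : [set t | _] = \bigcap_(i in [set: 'I_N])
      ((fun t : coeffs R N => tnth t i) @^-1` A (lift ord0 i))).
    apply: fin_bigcap_measurable => // i _; rewrite -[X in measurable X]setTI.
    exact: measurable_tnth.
  by apply/seteqP; split=> [t h i _|t h i]; [exact: h|exact: (h i)].
rewrite big_ord_recl -IH// -product_measure1E// /pushforward.
congr product_measure1; apply/seteqP; split=> [[x t] /= h|[x t] /= [hx h] i].
  split; first by have := h ord0; rewrite tnth0.
  by move=> i; have := h (lift ord0 i); rewrite tnthS.
by case: (unliftP ord0 i) => [j|] ->; rewrite ?tnthS.
Qed.

End lebesgue_tuple.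
Arguments lebesgue_tuple R N : clear implicits.

Section random_polynomial.
Variables (R : realType) (N : nat).

(* [tnth a i] is the coefficient of 'X^(N - (i + 1)): the tuple indexes the
   coefficients a_1, ..., a_N from 0. *)
Definition monic_poly (a : coeffs R N) : {poly R} :=
  'X^N + \sum_(i < N) (tnth a i : R) *: 'X^(N - i.+1).

Definition Omega : set (coeffs R N) :=
  [set a | forall z : R[i],
     root (map_poly (real_complex R) (monic_poly a)) z -> `|z| <= 1].

Definition Omega_volume : \bar R := lebesgue_tuple R N Omega.

(* Expectation for the normalized Lebesgue measure on [Omega]. *)
Definition Omega_mean (f : coeffs R N -> R) : \bar R :=
  (Omega_volume^-1 * \int[lebesgue_tuple R N]_(a in Omega) (f a)%:E)%E.

(* Distinct real zeros; a repeated zero, which occurs with probability 0, is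
   counted once. *)
Definition nb_zeros (u v : R) (a : coeffs R N) : nat :=
  #|` fset_set [set x : R | u <= x <= v /\ root (monic_poly a) x]|.

Definition expected_zeros (u v : R) : \bar R :=
  Omega_mean (fun a => (nb_zeros u v a)%:R).

End random_polynomial.
Arguments Omega R N : clear implicits.
Arguments Omega_volume R N : clear implicits.
Arguments expected_zeros {R} N u v.

(* Main.v *)
(* Split a zero T off a random polynomial, P = (x - T) Q. For a fixed non-constant
   part, the one-dimensional area formula in the constant coefficient, followed by
   the volume-preserving change of variables from the coefficients of P to those
   of Q, gives
     E_(N+1)[zeros in [a, b]] = D_N / D_(N+1) * int_a^b E_N |Q(T)| dT.
   The Schur-Cohn-Levinson recursion P = x Q + k x^N Q(1/x) with |k| < 1 fibres
   Omega_(N+1) over Omega_N and yields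
     D_(N+1) / D_N = int_(-1)^1 (1 - k^2)^j dk,  j = floor(N / 2).
   With u_n = 'C(2n, n) / 4^n and x = T^2, the conjectural formulas turn the
   integrand into
     (1/2) (sum_k (2(m-k)+1) u_(m-k) u_k x^k) (sum_k u_(m'-k) u_k x^k)
   with m = floor(N/2) and m' = ceil(N/2). By Wallis (2m+1) u_m^2 -> 2 / pi, and
   sum_k u_k x^k = (1 - x)^(-1/2), so it tends to 1 / (pi (1 - T^2)) and dominated
   convergence applies. *)

From HB Require Import structures.
Require Import Defs.
From mathcomp Require Import all_boot all_order all_algebra.
From mathcomp Require Import finmap.
From mathcomp Require Import complex.
From mathcomp Require Import all_classical all_reals all_analysis.
From mathcomp Require Import measurable_realfun.
From mathcomp Require polyrcf.
From mathcomp Require Import ring lra zify.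

Set Implicit Arguments.
Unset Strict Implicit.
Unset Printing Implicit Defensive.

Import Order.TTheory GRing.Theory Num.Theory.
Import numFieldNormedType.Exports.

Local Open Scope classical_set_scope.
Local Open Scope ring_scope.

(** * The area formula for polynomials *)

Section area_formula.
Variable R : realType.
Local Notation mu := (@lebesgue_measure R).
Implicit Types (p : {poly R}) (s t : R) (A D : set R).

(** At a zero T of P = (x - T) Q one has P'(T) = Q(T): this turns the weight |P'(T)| of the area
    formula into |Q(T)|, one degree lower. The Levinson step multiplies volume by 1 - k^2 for each
    mirror pair of coefficients and, for odd N, by 1 + k for the middle one. The extra term k (1 -
    k^2)^j is odd in k and integrates to 0, whence the same exponent floor(N / 2) for both parities.
    Measurability is an obstacle, because both Omega_N and the number of zeros are defined through
    roots. For Omega_N the recursion is inverted where |k| < 1, and dilations reach the boundary |k|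
    = 1; for the zeros, rational points separate the smallest zero from the others. In the limit of
    the density the weights u_(m-k) / u_m tend to 1 for fixed k but are unbounded over k <= m. The
    majorant 2k + 1 grows with k and is still summable against x^k, uniformly for |T| <= r < 1. *)

Lemma density_measure (f : R -> \bar R) :
  measurable_fun [set: R] f -> (forall x, (0 <= f x)%E) ->
  exists m : {measure set (measurableTypeR R) -> \bar R},
    forall A, m A = (\int[mu]_(x in A) f x)%E.
Proof.
move=> mf f0; pose nu A := (\int[mu]_(x in A) f x)%E.
have nu0 : nu set0 = 0%E by rewrite /nu integral_set0.
have nu_ge0 A : (0 <= nu A)%E by exact: integral_ge0.
have nuU : semi_sigma_additive (nu : set (measurableTypeR R) -> \bar R).
  by apply: semi_sigma_additive_nng_induced => //; exact: f0.
pose mixin := isMeasure.Build _ _ _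
  (nu : set (measurableTypeR R) -> \bar R) nu0 nu_ge0 nuU.
pose m : {measure set (measurableTypeR R) -> \bar R} :=
  HB.pack (nu : set (measurableTypeR R) -> \bar R) mixin.
by exists m.
Qed.

(** Off [D] the extended map takes the junk value 0, which the restriction of [mu] to [D] does not
    see. *)
Lemma restricted_pushforward_measure D (q : R -> R) :
  measurable D -> measurable_fun D q ->
  exists m : {measure set (measurableTypeR R) -> \bar R},
    forall A, measurable A -> m A = mu (D `&` q @^-1` A).
Proof.
move=> mD mq; pose q' := (q \_ D : measurableTypeR R -> measurableTypeR R).
have mq' : measurable_fun [set: measurableTypeR R] q'.
  exact/(measurable_restrictT _ mD).
pose nu := pushforward (mrestr mu mD) q'.
have nu0 : nu set0 = 0%E.
  by rewrite /nu /pushforward preimage_set0 measure0.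
have nu_ge0 A : (0 <= nu A)%E by rewrite /nu /pushforward measure_ge0.
have nuU : semi_sigma_additive nu.
  exact: (@measure_semi_sigma_additive _ _ _
    (measure_function_pushforward__canonical__measure_function_Measure
     (mrestr mu mD) mq')).
pose mixin := isMeasure.Build _ _ _ nu nu0 nu_ge0 nuU.
pose m : {measure set (measurableTypeR R) -> \bar R} := HB.pack nu mixin.
exists m => A mA; rewrite /m /= /nu /pushforward /mrestr.
congr (mu _); rewrite setIC; apply/seteqP; split=> x [Dx]/=;
  by rewrite /q' /patch mem_set.
Qed.

End area_formula.

Section area_formula.
Variable R : realType.
Local Notation mu := (@lebesgue_measure R).
Implicit Types (p : {poly R}) (s t : R) (A D : set R).
(** The sign is assumed only inside the interval, since the endpoints will be critical points; the
    mean value theorem needs no more. *)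
Lemma deriv_gt0_lt p s t : (forall x, s < x < t -> 0 < p^`().[x]) ->
  forall x y, s <= x -> x < y -> y <= t -> p.[x] < p.[y].
Proof.
move=> p'_gt0 x y sx xy yt.
have cp : {within `[x, y], continuous (horner p)}.
  exact/continuous_subspaceT/continuous_horner.
have [z zxy E] := MVT xy (fun z _ => is_derive_poly p z) cp.
rewrite -subr_gt0 E mulr_gt0 ?subr_gt0// p'_gt0//.
by move: zxy; rewrite in_itv/= => /andP[xz zy]; rewrite (le_lt_trans sx)//= (lt_le_trans zy).
Qed.

Lemma integral_deriv_poly p s t : s < t ->
  (\int[mu]_(x in `]s, t]) (p^`().[x])%:E = (p.[t] - p.[s])%:E)%E.
Proof.
move=> st; rewrite integral_itv_obnd_cbnd; last first.
  by apply/measurable_EFinP; exact: measurable_poly.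
rewrite (@continuous_FTC2 _ (horner p^`()) (horner p))//.
- exact/continuous_subspaceT/continuous_horner.
- split.
  + by move=> x _; exact: derivable_horner.
  + by apply: cvg_at_right_filter; exact: continuous_horner.
  + by apply: cvg_at_left_filter; exact: continuous_horner.
- by move=> x _; rewrite derivE.
Qed.

Section increasing_piece.
Variables (p : {poly R}) (s t : R).
Hypothesis p'_gt0 : forall x, s < x < t -> 0 < p^`().[x].
Hypothesis st : s < t.

Let D : set R := `]p.[s], p.[t]].
Let q (c : R) : R := xget s [set x | s < x <= t /\ p.[x] = c].

Let p_lt x y : s <= x -> x < y -> y <= t -> p.[x] < p.[y].
Proof. exact: deriv_gt0_lt. Qed.

Let p_le x y : s <= x -> x <= y -> y <= t -> p.[x] <= p.[y].
Proof.
by move=> sx; rewrite le_eqVlt => /predU1P[->//|xy] yt; rewrite ltW// p_lt.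
Qed.

Let qP c : D c -> s < q c <= t /\ p.[q c] = c.
Proof.
rewrite /D/= in_itv/= => /andP[sc ct].
apply: (@xgetPex _ s [set x | s < x <= t /\ p.[x] = c]).
have [||x] := @IVT R (horner p) s t c (ltW st).
- exact/continuous_subspaceT/continuous_horner.
- have pst : p.[s] <= p.[t] by rewrite ltW// p_lt.
  by rewrite (min_idPl pst) (max_idPr pst) (ltW sc) ct.
rewrite in_itv/= => /andP[sx xt] pxc; exists x; split=> //; rewrite xt andbT.
by rewrite lt_neqAle sx andbT; apply: contraTneq sc => ->; rewrite -pxc ltxx.
Qed.

Let pD x : s < x <= t -> D p.[x].
Proof.
by move=> /andP[sx xt]; rewrite /D/= in_itv/= p_lt//= p_le// ltW.
Qed.

Let qp x : s < x <= t -> q p.[x] = x.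
Proof.
move=> sxt; have [/andP[sq qt] pq] := qP (pD sxt).
have /andP[sx xt] := sxt.
have [qx|xq|//] := ltgtP (q p.[x]) x.
- by have := p_lt (ltW sq) qx xt; rewrite pq ltxx.
- by have := p_lt (ltW sx) xq qt; rewrite pq ltxx.
Qed.

Let imageE A : horner p @` (A `&` `]s, t]) = D `&` q @^-1` A.
Proof.
apply/seteqP; split=> [_ [x [Ax]/= + <-]|c [Dc Aqc]].
  by rewrite in_itv/= => sxt; split; [exact: pD|rewrite /= qp].
by have [qst pq] := qP Dc; exists (q c) => //; split=> //=; rewrite in_itv/=.
Qed.

Let mq : measurable_fun D q.
Proof.
apply: (measurability (@RGenOInfty.G R)) => [|/= _ [_] [r] -> <-].
  exact: RGenOInfty.measurableE.
(* The inverse branch [q] is monotone, so the preimage of a ray is an interval. *)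
apply: is_interval_measurable => c1 c2 [Dc1 +] [Dc2 _] c /andP[c1c cc2].
rewrite /= !in_itv/= !andbT => rq.
have Dc : D c.
  move: Dc1 Dc2; rewrite /D/= !in_itv/= => /andP[h1 _] /andP[_ h2].
  by rewrite (lt_le_trans h1)// (le_trans cc2).
split=> //; rewrite /= (lt_le_trans rq)// leNgt.
have [/andP[_ q1t] pq1] := qP Dc1; have [/andP[sq _] pq] := qP Dc.
apply/negP => /(p_lt (ltW sq))/(_ q1t).
by rewrite pq pq1 ltNge c1c.
Qed.

Let dens (x : R) : \bar R := (`|p^`().[x]|)%:E.

Let mdens (A : set R) : measurable_fun A dens.
Proof.
by apply/measurable_EFinP; apply: measurableT_comp => //; exact: measurable_poly.
Qed.

Let imageoc x y : s <= x -> x < y -> y <= t ->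
  horner p @` `]x, y] = `]p.[x], p.[y]]%classic.
Proof.
move=> sx xy yt; apply/seteqP; split=> [_ [z]/= + <-|c]/=; rewrite !in_itv/=.
  move=> /andP[xz zy].
  by rewrite p_lt//= ?(le_trans zy)// p_le ?(le_trans sx)// ltW.
move=> /andP[xc cy].
have Dc : D c.
  by rewrite /D/= in_itv/= (le_lt_trans _ xc) ?p_le ?(le_trans cy)// ?p_le//
    ?(le_trans sx)// ltW// (lt_le_trans xy).
have [/andP[sq qt] pq] := qP Dc; exists (q c) => //; rewrite in_itv/=.
apply/andP; split; rewrite ltNge || rewrite leNgt; apply/negP.
  by move=> /(p_le (ltW sq))/(_ (ltW (lt_le_trans xy yt))); rewrite pq leNgt xc.
by move=> /(p_lt (le_trans sx (ltW xy)))/(_ qt); rewrite pq ltNge cy.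
Qed.

(** As functions of [A], both sides are measures: the left one is a pushforward along the inverse
    branch [q], the right one has a density. They agree on half-open intervals by the fundamental
    theorem of calculus, hence on all Borel sets. *)
Lemma increasing_piece A : measurable A ->
  measurable (horner p @` (A `&` `]s, t])) /\
  (mu (horner p @` (A `&` `]s, t])) =
   \int[mu]_(x in A `&` `]s, t]) (`|p^`().[x]|)%:E)%E.
Proof.
move=> mA; split; first by rewrite imageE; apply: mq => //; exact: measurable_itv.
have [m1 m1E] := restricted_pushforward_measure (measurable_itv _ : measurable D) mq.
have mdens1 : measurable_fun [set: R] (dens \_ `]s, t]).
  by apply/(measurable_restrictT _ (measurable_itv _)); exact: mdens.
have dens0 x : (0 <= (dens \_ `]s, t]) x)%E.
  by rewrite patchE; case: ifP => // _; rewrite lee_fin.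
have [m2 m2E] := density_measure mdens1 dens0.
rewrite imageE -m1E// integral_mkcondr -m2E.
apply: (@measure_unique _ R (measurableTypeR R) (@ocitv R)
  (fun n => `](- n%:R), n%:R]%classic)) => //.
- exact: ocitvI.
- by move=> n; exists (- n%:R, n%:R).
- apply/seteqP; split=> // x _; exists (Num.bound `|x|).+1 => //=.
  have := archi_boundP (normr_ge0 x); rewrite in_itv/= ltr_norml => /andP[h1 h2].
  rewrite -natr1; apply/andP; split.
    by apply: le_lt_trans h1; rewrite lerN2 lerDl.
  by rewrite (le_trans (ltW h2))// lerDl.
- move=> _ [[x y] _ <-]/=; rewrite m1E// -imageE m2E -integral_mkcondr.
  have -> : `]x, y] `&` `]s, t] = `](Num.max x s), (Num.min y t)]%classic.
    apply/seteqP; split=> z /=; rewrite !in_itv/= gt_max le_min.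
      by move=> [/andP[-> ->] /andP[-> ->]].
    by move=> /andP[/andP[-> ->] /andP[-> ->]].
  have [xy|yx] := ltP (Num.max x s) (Num.min y t); last first.
    by rewrite set_itv_ge ?bnd_simp -?leNgt// image_set0 measure0 integral_set0.
  rewrite imageoc// ?le_max ?lexx ?orbT// ?ge_min ?lexx ?orbT//.
  rewrite lebesgue_measure_itv/= lte_fin p_lt//; last 2 first.
    by rewrite le_max lexx orbT.
    by rewrite ge_min lexx orbT.
  rewrite -EFinB -integral_deriv_poly//.
  (* The right endpoint is dropped, because the derivative is known to be positive only inside. *)
  rewrite -!integral_itv_bndo_bndc; last 2 first.
    exact: mdens.
    by apply/measurable_EFinP; exact: measurable_poly.
  apply: eq_integral => z; rewrite inE/= in_itv/= gt_max lt_min.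
  move=> /andP[/andP[_ sz] /andP[_ zt]].
  by rewrite /dens gtr0_norm// p'_gt0// sz zt.
- move=> n; rewrite m1E//; apply: le_lt_trans (_ : mu D < +oo)%E.
    apply: le_measure; rewrite ?inE; last exact: subIsetl.
    - by apply: mq => //; exact: measurable_itv.
    - exact: measurable_itv.
  by rewrite lebesgue_measure_itv/= lte_fin p_lt//= -EFinB ltry.
Qed.

End increasing_piece.
End area_formula.

(** * Gluing the monotone pieces of a polynomial *)

Section polynomial_area.
Variable R : realType.
Local Notation mu := (@lebesgue_measure R).
Implicit Types (p : {poly R}) (s t : R) (A D : set R).

Definition fiber p s t A (c : R) : set R := A `&` `]s, t] `&` horner p @^-1` [set c].

(** [A] stays free so that membership in [Omega] can later be carried along as a condition on the
    zero; half-open intervals make the pieces of a subdivision disjoint. *)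
Definition area_formula p s t := forall A, measurable A ->
  measurable_fun [set: R] (fun c => counting (fiber p s t A c) : \bar R) /\
  (\int[mu]_c counting (fiber p s t A c) =
   \int[mu]_(x in A `&` `]s, t]) (`|p^`().[x]|)%:E)%E.

Lemma counting_set1 (x : R) : counting [set x] = 1%:E :> \bar R.
Proof. by rewrite /counting asboolT// fset_set1 cardfs1. Qed.

Lemma counting_fiber_inj p s t A c :
  {in `]s, t] &, injective (horner p)} ->
  counting (fiber p s t A c) = (\1_(horner p @` (A `&` `]s, t])) c)%:E :> \bar R.
Proof.
move=> pinj; rewrite indicE; have [/set_mem[x [Ax stx] <-]|pc] := boolP (c \in _).
  rewrite (_ : fiber _ _ _ _ _ = [set x]) ?counting_set1//.
  apply/seteqP; split=> [y [[_ sty]] pyx|_ ->//]/=.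
  by apply: pinj; rewrite ?inE.
rewrite (_ : fiber _ _ _ _ _ = set0) ?measure0//.
apply/seteqP; split=> // x [Ax pxc]; case/negP: pc; rewrite inE.
by exists x.
Qed.

Lemma measurable_fiber p s t A c : measurable A -> measurable (fiber p s t A c).
Proof.
move=> mA; apply: measurableI; first exact: measurableI.
by rewrite -[X in measurable X]setTI; exact: measurable_poly.
Qed.

Lemma area_formula_inj p s t : {in `]s, t] &, injective (horner p)} ->
  (forall A, measurable A -> measurable (horner p @` (A `&` `]s, t])) /\
  (mu (horner p @` (A `&` `]s, t])) =
   \int[mu]_(x in A `&` `]s, t]) (`|p^`().[x]|)%:E)%E) ->
  area_formula p s t.
Proof.
move=> pinj h A mA; have [mpA <-] := h A mA.
have E : (fun c => counting (fiber p s t A c) : \bar R) =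
    (fun c => (\1_(horner p @` (A `&` `]s, t])) c)%:E).
  by apply/funext => c; exact: counting_fiber_inj.
split; first by rewrite E; apply/measurable_EFinP; exact: measurable_indic.
by under eq_integral do rewrite counting_fiber_inj//; rewrite integral_indic// setIT.
Qed.

Lemma area_formula_split p s r t : s <= r -> r <= t ->
  area_formula p s r -> area_formula p r t -> area_formula p s t.
Proof.
move=> sr rt h1 h2 A mA; have [m1 i1] := h1 A mA; have [m2 i2] := h2 A mA.
have st : `]s, t]%classic = `]s, r] `|` `]r, t] :> set R.
  by rewrite -itv_bndbnd_setU ?bnd_simp.
have disj : `]s, r] `&` `]r, t] = set0 :> set R.
  apply/seteqP; split=> // x [] /=; rewrite !in_itv/= => /andP[_ xr] /andP[rx _].
  by move: rx; rewrite ltNge xr.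
have E c : counting (fiber p s t A c) =
    (counting (fiber p s r A c) + counting (fiber p r t A c))%E :> \bar R.
  rewrite -measureU; [|exact: measurable_fiber|exact: measurable_fiber|].
    by congr counting; rewrite /fiber st setIUr setIUl.
  apply/seteqP; split=> // x [[[_ xs] _] [[_ xr] _]].
  by rewrite -disj.
split; first by under eq_fun do rewrite E; exact: emeasurable_funD.
under eq_integral do rewrite E.
rewrite ge0_integralD//= i1 i2 st setIUr ge0_integral_setU//=.
- exact: measurableI.
- exact: measurableI.
- by apply/measurable_EFinP; apply: measurableT_comp => //; exact: measurable_poly.
- apply/disj_setPS => x [[_ xs] [_ xr]]; by rewrite -disj.
Qed.

Lemma no_root_sign p s t : (forall x, s < x < t -> ~~ root p x) ->
  (forall x, s < x < t -> 0 < p.[x]) \/ (forall x, s < x < t -> p.[x] < 0).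
Proof.
move=> nr.
have nr' x y : s < x < t -> s < y < t -> p.[x] * p.[y] <= 0 -> False.
  wlog xy : x y / x <= y.
    by move=> h sx sy; have [/h|/ltW/h] := leP x y; [apply|rewrite mulrC; apply].
  move=> /andP[sx _] /andP[_ yt] /(polyrcf.poly_ivt xy)[z].
  rewrite in_itv/= => /andP[xz zy]; apply/negP/nr.
  by rewrite (lt_le_trans sx)//= (le_lt_trans zy).
have [ts|st] := leP t s.
  left=> x /andP[sx xt].
  by have := lt_trans sx xt; rewrite ltNge ts.
have /midf_lt[sm mt] := st; set m := _ / _ in sm mt.
have smt : s < m < t by rewrite sm mt.
have [pm|pm|pm] := ltgtP p.[m] 0.
- right=> x sxt; rewrite ltNge; apply/negP => px.
  by apply: (nr' m x) => //; rewrite nmulr_rle0.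
- left=> x sxt; rewrite ltNge; apply/negP => px.
  by apply: (nr' m x) => //; rewrite pmulr_rle0.
- by have := nr _ smt; rewrite rootE pm eqxx.
Qed.

(** Induction on a bound for the number of critical points strictly inside the interval: splitting
    at one of them lowers the bound on both sides, and without any the polynomial is strictly
    monotone. The bound is phrased through duplicate-free lists of roots, so that the splitting
    point can be put in front of a list. *)
Lemma area_formula_poly p s t : p^`() != 0 -> s <= t -> area_formula p s t.
Proof.
move=> p'0.
have : forall rs : seq R, uniq rs -> all (fun r => root p^`() r && (s < r < t)) rs ->
    (size rs < size p^`())%N.
  move=> rs urs /allP rsP; apply: max_poly_roots => //.
  by apply/allP => r /rsP /andP[].
elim: (size p^`()) s t => [s t /(_ [::] isT isT)//|k IH s t h].
rewrite le_eqVlt => /predU1P[->|st].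
  move=> A mA; have E : (fun c => counting (fiber p t t A c) : \bar R) = cst 0%E.
    by apply/funext => c; rewrite /fiber set_itvoc0 setI0 set0I measure0.
  by rewrite E set_itvoc0 setI0 integral_set0 integral0.
have [[r /andP[sr rt] pr0]|nr] := pselect (exists2 r, s < r < t & root p^`() r).
  apply: (@area_formula_split _ s r t (ltW sr) (ltW rt)); apply: IH => //; last 1 first.
  - exact: ltW.
  - move=> rs urs /allP rsP; have := h (r :: rs).
    rewrite /= urs pr0 sr rt !andbT/= ltnS; apply.
      by apply/negP => /rsP; rewrite ltxx !andbF.
    by apply/allP => x /rsP/andP[-> /andP[-> /=]] xr; rewrite (lt_trans xr).
  - exact: ltW.
  - move=> rs urs /allP rsP; have := h (r :: rs).
    rewrite /= urs pr0 sr rt !andbT/= ltnS; apply.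
      by apply/negP => /rsP; rewrite ltxx !andbF.
    by apply/allP => x /rsP/andP[-> /andP[+ ->]] => /= rx; rewrite (lt_trans sr).
have nr' x : s < x < t -> ~~ root p^`() x.
  by move=> sxt; apply/negP => rx; apply: nr; exists x.
have [pos|neg] := no_root_sign nr'.
  apply: area_formula_inj; last by move=> A mA; exact: increasing_piece.
  move=> x y; rewrite !in_itv/= => /andP[sx xt] /andP[sy yt] pxy.
  have [xy|yx|//] := ltgtP x y.
  - by have := deriv_gt0_lt pos (ltW sx) xy yt; rewrite pxy ltxx.
  - by have := deriv_gt0_lt pos (ltW sy) yx xt; rewrite pxy ltxx.
(* The decreasing case is the increasing case for [- p], as Lebesgue measure is invariant under
   reflection. *)
have pos x : s < x < t -> 0 < (- p)^`().[x].
  by move=> /neg; rewrite derivN hornerN oppr_gt0.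
apply: area_formula_inj => [x y|A mA].
  rewrite !in_itv/= => /andP[sx xt] /andP[sy yt] pxy.
  have [xy|yx|//] := ltgtP x y.
  - by have := deriv_gt0_lt pos (ltW sx) xy yt; rewrite !hornerN pxy ltxx.
  - by have := deriv_gt0_lt pos (ltW sy) yx xt; rewrite !hornerN pxy ltxx.
have [mI muI] := increasing_piece pos st mA.
have E : horner p @` (A `&` `]s, t]) =
   -%R @^-1` (horner (- p) @` (A `&` `]s, t])).
  apply/seteqP; split=> [_ [x Ax <-]|c [x Ax]]; first by exists x; rewrite ?hornerN.
  by rewrite hornerN => /oppr_inj <-; exists x.
split; first by rewrite E -[X in measurable X]setTI; exact: oppr_measurable.
rewrite E; have := lebesgue_measureN mI; rewrite /pushforward => ->.
by rewrite muI; apply: eq_integral => x _; rewrite derivN hornerN normrN.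
Qed.

End polynomial_area.

(** * Changes of variables in coefficient space *)

Section tuple_fubini.
Variable R : realType.
Local Notation mu := (@lebesgue_measure R).
Local Notation ltu := (lebesgue_tuple R).

Lemma integral_tuple_cons N (f : coeffs R N.+1 -> \bar R) :
  measurable_fun [set: coeffs R N.+1] f -> (forall x, 0 <= f x)%E ->
  (\int[ltu N.+1]_t f t = \int[mu]_x \int[ltu N]_t f (tuple_cons (x, t)))%E.
Proof.
move=> mf f0.
have mc := @measurable_tuple_cons R N.
have mfc := measurableT_comp mf mc.
have := @fubini_tonelli1 _ _ _ _ R mu (ltu N) _ mfc (fun x => f0 _).
rewrite /fubini_F => <-.
by rewrite -(@ge0_integral_pushforward _ _ _ _ _ _ mc (mu \x ltu N)%E setT).
Qed.

Lemma measurable_section_cons N d (T : measurableType d) (f : coeffs R N.+1 -> T) x :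
  measurable_fun [set: coeffs R N.+1] f ->
  measurable_fun [set: coeffs R N] (fun t => f (tuple_cons (x, t))).
Proof.
move=> mf; apply: (measurableT_comp mf).
apply: (@measurable_cons _ _ _ _ (cst x) _ id); first exact: measurable_cst.
exact: measurable_id.
Qed.

Definition tuple_rcons N (p : coeffs R N * measurableTypeR R) : coeffs R N.+1 :=
  [tuple of rcons p.1 p.2].

Lemma measurable_tuple_rcons N : measurable_fun [set: _] (@tuple_rcons N).
Proof.
apply/measurable_fun_tnthP => i.
have [iN|Ni] := ltnP i N.
  rewrite (_ : _ \o _ = (fun p => tnth p.1 (Ordinal iN))).
    by apply: (measurableT_comp (measurable_tnth _)).
  apply/funext => -[t c] /=.
  by rewrite !(tnth_nth 0)/= nth_rcons size_tuple iN.
rewrite (_ : _ \o _ = snd)//.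
apply/funext => -[t c] /=.
rewrite (tnth_nth 0)/= nth_rcons size_tuple ltnNge Ni/=.
by rewrite eqn_leq Ni -ltnS ltn_ord.
Qed.

Lemma integral_tuple0 (f : coeffs R 0 -> \bar R) :
  (\int[ltu 0]_t f t = f [tuple])%E.
Proof.
have E : f = cst (f [tuple]) by apply/funext => t; rewrite tuple0.
by rewrite E integral_cst//= diracT mule1.
Qed.

(** The measure is built by peeling off the first coordinate, whereas the constant coefficient, to
    which the area formula applies, is the last one. *)
Lemma integral_tuple_rcons N (f : coeffs R N.+1 -> \bar R) :
  measurable_fun [set: coeffs R N.+1] f -> (forall x, 0 <= f x)%E ->
  (\int[ltu N.+1]_t f t = \int[ltu N]_t \int[mu]_c f (tuple_rcons (t, c)))%E.
Proof.
elim: N f => [|N IH] f mf f0.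
  rewrite integral_tuple_cons// integral_tuple0; apply: eq_integral => x _.
  rewrite integral_tuple0; congr f; exact: val_inj.
have mF : measurable_fun [set: coeffs R N.+1]
    (fun t => \int[mu]_c f (tuple_rcons (t, c)))%E.
  apply: (measurable_fun_fubini_tonelli_F (m2 := mu) (f \o @tuple_rcons N.+1)).
    by apply: measurableT_comp => //; exact: measurable_tuple_rcons.
  by move=> x /=.
rewrite integral_tuple_cons// integral_tuple_cons//; last first.
  by move=> x; apply: integral_ge0.
apply: eq_integral => x _; rewrite IH//; last exact: measurable_section_cons.
apply: eq_integral => t _; apply: eq_integral => c _.
by congr f; exact: val_inj.
Qed.

(** The one-dimensional change of variables to which all the others reduce; the rescaled pushforward
    agrees with Lebesgue measure on intervals. *)
Lemma integral_affine (g : R -> \bar R) (c d : R) : 0 < c ->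
  measurable_fun [set: R] g -> (forall x, 0 <= g x)%E ->
  (c%:E * \int[mu]_x g (c * x + d)%R = \int[mu]_x g x)%E.
Proof.
move=> c0 mg g0.
pose phi (x : measurableTypeR R) : measurableTypeR R := c * x + d.
have mphi : measurable_fun [set: measurableTypeR R] phi.
  by apply: measurable_funD => //; exact: measurable_funM.
pose cn : {nonneg R} := NngNum (ltW c0).
pose m := mscale cn
  (measure_function_pushforward__canonical__measure_function_Measure mu mphi).
have E A : measurable A -> mu A = m A.
  apply: lebesgue_measure_unique => _ [[a b] _ <-].
  rewrite /m/= /mscale/= /pushforward lebesgue_measure_itv/=.
  have -> : phi @^-1` `]a, b] = `](a - d) / c, (b - d) / c]%classic.
    apply/seteqP; split=> x; rewrite /phi/= !in_itv/=;
    by rewrite ltr_pdivrMr// ler_pdivlMr// ltrBlDr lerBrDr (mulrC x).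
  rewrite lebesgue_measure_itv/= !lte_fin ltr_pM2r ?invr_gt0// ltrD2r.
  case: ifPn => _; last by rewrite mule0.
  by rewrite -!EFinB -EFinM; congr EFin; field; rewrite gt_eqF.
have -> : (\int[mu]_x g x = \int[m]_x g x)%E.
  by apply: eq_measure_integral => A mA _; exact: E.
rewrite ge0_integral_mscale//=; congr (_ * _)%E; apply/esym.
exact: (ge0_integral_pushforward mphi mu measurableT mg (fun x _ => g0 x)).
Qed.

End tuple_fubini.

(** * Volume factors of linear maps on coefficient tuples *)

Section tuple_maps.
Variable R : realType.
Local Notation mu := (@lebesgue_measure R).
Local Notation ltu := (lebesgue_tuple R).
Local Notation mR := (measurableTypeR R).

(* ['X * P] with [P] the polynomial of [shear T 1 q] is ['X - T] times the polynomial
   of [q], up to the constant term; [prev] is the coefficient preceding [t]. *)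
Definition shear N (T prev : R) (t : coeffs R N) : coeffs R N :=
  [tuple (tnth t i : R) - T * nth 0 (prev :: t) i | i < N].

Lemma shear_cons N T prev x (t : coeffs R N) :
  shear T prev (tuple_cons (x, t)) = tuple_cons (x - T * prev, shear T x t).
Proof.
apply: eq_from_tnth => i; rewrite tnth_mktuple.
have [j ->|->] := unliftP ord0 i; last by rewrite !tnth0.
by rewrite !tnthS tnth_mktuple.
Qed.

Lemma measurable_shear N d (X : measurableType d) (T prev : X -> mR)
    (t : X -> coeffs R N) :
  measurable_fun [set: X] T -> measurable_fun [set: X] prev ->
  measurable_fun [set: X] t ->
  measurable_fun [set: X] (fun x => shear (T x) (prev x) (t x)).
Proof.
move=> mT mprev mt; apply/measurable_fun_tnthP => i.
rewrite (_ : _ \o _ = fun x => (tnth (t x) i : R) - T x * nth 0 (prev x :: t x) i).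
  apply: measurable_funB.
    by apply: (measurableT_comp (measurable_tnth i)).
  apply: measurable_funM => //.
  have h := measurable_cons mprev mt.
  have iN : (i < N.+1)%N by rewrite (ltn_trans (ltn_ord i)).
  have := measurableT_comp (measurable_tnth (Ordinal iN)) h.
  by congr measurable_fun; apply/funext => x; rewrite /= (tnth_nth 0).
by apply/funext => x; rewrite /= tnth_mktuple.
Qed.

(** The map is triangular with unit diagonal: once the preceding coordinate is fixed, each
    coordinate is merely translated. [prev] is general because in the induction the first coordinate
    takes its place. *)
Lemma integral_shear N (T prev : R) (f : coeffs R N -> \bar R) :
  measurable_fun [set: coeffs R N] f -> (forall x, 0 <= f x)%E ->
  (\int[ltu N]_t f (shear T prev t) = \int[ltu N]_t f t)%E.
Proof.
elim: N prev f => [|N IH] prev f mf f0.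
  by rewrite !integral_tuple0 [shear _ _ _]tuple0.
rewrite integral_tuple_cons//; last first.
  apply: (measurableT_comp mf).
  apply: measurable_shear; [exact: measurable_cst|exact: measurable_cst|exact: measurable_id].
rewrite integral_tuple_cons//.
pose F (x : mR) := (\int[ltu N]_t f (tuple_cons (x, t)))%E.
have mF : measurable_fun [set: mR] F.
  apply: (measurable_fun_fubini_tonelli_F (m2 := ltu N) (f \o @tuple_cons R N)) => //.
    by apply: measurableT_comp => //; exact: measurable_tuple_cons.
  by move=> x /=.
have F0 x : (0 <= F x)%E by exact: integral_ge0.
rewrite -(integral_affine (- (T * prev)) ltr01 mF F0) mul1e.
apply: eq_integral => x _; rewrite mul1r.
transitivity (\int[ltu N]_t f (tuple_cons (((x : R) - T * prev)%R, shear T x t)))%E.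
  by apply: eq_integral => t _; rewrite shear_cons.
rewrite (IH x (fun t => f (tuple_cons ((x : R) - T * prev, t))))//.
exact: measurable_section_cons.
Qed.

(* The coefficients of [x Q + k x^N Q(1/x)], constant term [k] excepted. *)
Definition fold_rev N (k : R) (t : coeffs R N) : coeffs R N :=
  [tuple (tnth t i : R) + k * tnth t (rev_ord i) | i < N].

Lemma measurable_fold_rev N d (X : measurableType d) (k : X -> mR)
    (t : X -> coeffs R N) :
  measurable_fun [set: X] k -> measurable_fun [set: X] t ->
  measurable_fun [set: X] (fun x => fold_rev (k x) (t x)).
Proof.
move=> mk mt; apply/measurable_fun_tnthP => i.
rewrite (_ : _ \o _ = fun x => (tnth (t x) i : R) + k x * tnth (t x) (rev_ord i)).
  apply: measurable_funD; first by apply: (measurableT_comp (measurable_tnth i)).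
  apply: measurable_funM => //.
  by apply: (measurableT_comp (measurable_tnth (rev_ord i))).
by apply/funext => x; rewrite /= tnth_mktuple.
Qed.

(** Adds an outermost mirror pair, the unit by which the induction for [fold_rev] proceeds. *)
Definition wrap N (p : mR * mR * coeffs R N) : coeffs R N.+2 :=
  tuple_cons (p.1.1, tuple_rcons (p.2, p.1.2)).

Lemma measurable_wrap N : measurable_fun [set: _] (@wrap N).
Proof.
apply: measurable_cons.
  exact: (measurableT_comp measurable_fst measurable_fst).
apply: (measurableT_comp (@measurable_tuple_rcons R N)).
apply: measurable_fun_pair; first exact: measurable_snd.
exact: (measurableT_comp measurable_snd measurable_fst).
Qed.

Lemma fold_rev_wrap N k x y (t : coeffs R N) :
  fold_rev k (wrap (x, y, t)) = wrap (x + k * y, y + k * x, fold_rev k t).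
Proof.
apply: eq_from_tnth => i; rewrite tnth_mktuple !(tnth_nth 0)/=.
case: i => -[|i] iN /=; first by rewrite nth_rcons size_tuple ltnn eqxx.
rewrite subSS !nth_rcons size_map size_enum_ord !size_tuple.
move: (iN); rewrite ltnS ltnS leq_eqVlt => /predU1P[->|iN'].
  by rewrite ltnn eqxx subnn.
rewrite iN' (nth_map (Ordinal iN')) ?size_enum_ord//.
rewrite -[i in nth _ (enum _) i]/(val (Ordinal iN')) nth_ord_enum.
rewrite !(tnth_nth 0)/= subSn//= nth_rcons size_tuple.
have h : (N - i.+1 < N)%N by rewrite ltn_subrL (leq_ltn_trans _ iN').
by rewrite h.
Qed.

Lemma integral_wrap N (f : coeffs R N.+2 -> \bar R) :
  measurable_fun [set: coeffs R N.+2] f -> (forall x, 0 <= f x)%E ->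
  (\int[ltu N.+2]_t f t =
   \int[mu]_x \int[mu]_y \int[ltu N]_t f (wrap (x, y, t)))%E.
Proof.
move=> mf f0; rewrite integral_tuple_cons//; apply: eq_integral => x _.
rewrite integral_tuple_rcons//; last exact: measurable_section_cons.
rewrite (@fubini_tonelli _ _ _ _ R (ltu N) mu (fun p => f (tuple_cons (x, tuple_rcons p))))//.
exact: (measurableT_comp (measurable_section_cons x mf) (@measurable_tuple_rcons R N)).
Qed.

(** The matrix [[1, k], [k, 1]] is factored into (x, y) -> (x + k y, y) followed by (x, y) -> (x, (1
    - k^2) y + k x). Each factor is a one-dimensional affine change, and Tonelli exchanges the
    variables between the two. *)
Lemma integral_swap_shear (k : R) (G : mR * mR -> \bar R) : -1 < k < 1 ->
  measurable_fun [set: mR * mR] G -> (forall x, 0 <= G x)%E ->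
  ((1 - k ^+ 2)%:E * \int[mu]_x \int[mu]_y G ((x : R) + k * y, (y : R) + k * x)%R =
   \int[mu]_x \int[mu]_y G (x, y))%E.
Proof.
move=> /andP[k1 k2] mG G0.
have c0 : 0 < 1 - k ^+ 2 by nra.
have aff (a b c d : R) : measurable_fun [set: mR * mR]
    (fun p : mR * mR => (a * p.1 + b * p.2, c * p.1 + d * p.2) : mR * mR).
  by apply: measurable_fun_pair; apply: measurable_funD; apply: measurable_funM => //.
have mGG a b c d := measurableT_comp mG (aff a b c d).
pose H (p : mR * mR) := G (p.1, (1 - k ^+ 2) * p.2 + k * p.1).
have mH : measurable_fun [set: mR * mR] H.
  have := mGG 1 0 k (1 - k ^+ 2); congr measurable_fun.
  by apply/funext => -[x y] /=; rewrite /H/= mul1r mul0r addr0 addrC.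
pose G1 (p : mR * mR) := G ((p.1 : R) + k * p.2, (p.2 : R) + k * p.1).
have mG1 : measurable_fun [set: mR * mR] G1.
  have := mGG 1 k k 1; congr measurable_fun.
  by apply/funext => -[x y] /=; rewrite /G1/= !mul1r (addrC (k * x)).
have H0 p : (0 <= H p)%E by exact: G0.
have G10 p : (0 <= G1 p)%E by exact: G0.
transitivity ((1 - k ^+ 2)%:E * \int[mu]_x \int[mu]_y G1 (x, y))%E; first by [].
rewrite (@fubini_tonelli _ _ _ _ R mu mu G1)//=.
have -> : (\int[mu]_y \int[mu]_x G1 (x, y) =
           \int[mu]_y \int[mu]_x H (x, y))%E.
  apply: eq_integral => y _.
  have mHy : measurable_fun [set: mR] (fun x => H (x, y)).
    exact: (measurableT_comp mH (pair2_measurable y)).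
  have <- := integral_affine (k * y) ltr01 mHy (fun x => G0 _); rewrite mul1e.
  apply: eq_integral => x _; rewrite /G1/H/=; congr (G (_, _)); ring.
rewrite -(fubini_tonelli H)// -ge0_integralZl//=; last 3 first.
- exact: (measurable_fun_fubini_tonelli_F (m2 := mu) H).
- by move=> x _; exact: integral_ge0.
- by rewrite lee_fin ltW.
apply: eq_integral => x _.
have mGx : measurable_fun [set: mR] (fun y => G (x, y)).
  exact: (measurableT_comp mG (pair1_measurable x)).
exact: (integral_affine (k * x) c0 mGx).
Qed.

Definition fold_rev_jacobian N (k : R) : R := (1 - k ^+ 2) ^+ N./2 * (1 + k) ^+ odd N.

(* The map [fold_rev k] acts on each pair of mirror coordinates by the matrix
   [[1, k], [k, 1]], and on the middle one, if any, by [1 + k]. *)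
Lemma integral_fold_rev N (k : R) (f : coeffs R N -> \bar R) : -1 < k < 1 ->
  measurable_fun [set: coeffs R N] f -> (forall x, 0 <= f x)%E ->
  ((fold_rev_jacobian N k)%:E * \int[ltu N]_t f (fold_rev k t) = \int[ltu N]_t f t)%E.
Proof.
move=> k1; have [n] := ubnP N; elim: n N f => // n IH [|[|N]] f /=.
- move=> _ mf f0; rewrite /fold_rev_jacobian/= !expr0 mulr1 mul1e !integral_tuple0.
  by rewrite [fold_rev _ _]tuple0.
- move=> _ mf f0; rewrite /fold_rev_jacobian/= expr0 mul1r expr1.
  rewrite integral_tuple_cons//; last first.
    apply: (measurableT_comp mf).
    by apply: measurable_fold_rev; [exact: measurable_cst|exact: measurable_id].
  rewrite integral_tuple_cons//.
  under eq_integral do rewrite integral_tuple0.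
  under [in RHS]eq_integral do rewrite integral_tuple0.
  have k0 : 0 < 1 + k by lra.
  rewrite -(integral_affine 0 k0
    (_ : measurable_fun setT (fun x : mR => f (tuple_cons (x, [tuple])))))//.
    congr (_ * _)%E; apply: eq_integral => x _; congr f.
    apply: eq_from_tnth => i; rewrite tnth_mktuple !(tnth_nth 0)/=.
    by case: i => -[]//= _; rewrite addr0 mulrDl mul1r.
  apply: (measurableT_comp mf).
  by apply: (@measurable_cons _ _ _ _ id _ (cst [tuple])).
rewrite ltnS => Nn mf f0.
have mff : measurable_fun [set: coeffs R N.+2] (fun t => f (fold_rev k t)).
  apply: (measurableT_comp mf).
  by apply: measurable_fold_rev; [exact: measurable_cst|exact: measurable_id].
rewrite integral_wrap// integral_wrap//.
pose G (p : mR * mR) := (\int[ltu N]_t f (wrap (p, t)))%E.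
have mfw := measurableT_comp mf (@measurable_wrap N).
have mG : measurable_fun [set: mR * mR] G.
  exact: (measurable_fun_fubini_tonelli_F (m2 := ltu N) _ mfw (fun _ => f0 _)).
have G0 p : (0 <= G p)%E by exact: integral_ge0.
transitivity (\int[mu]_x \int[mu]_y G (x, y))%E; last first.
  by apply: eq_integral => x _; apply: eq_integral.
rewrite -(integral_swap_shear k1 mG G0).
have J : fold_rev_jacobian N.+2 k = (1 - k ^+ 2) * fold_rev_jacobian N k.
  by rewrite /fold_rev_jacobian/= negbK exprS mulrA.
have J0 : 0 <= fold_rev_jacobian N k.
  by rewrite mulr_ge0// exprn_ge0//; nra.
rewrite J EFinM -muleA; congr (_ * _)%E.
have mfwk : measurable_fun [set: mR * mR * coeffs R N]
    (fun p => f (fold_rev k (wrap p))).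
  exact: (measurableT_comp mff (@measurable_wrap N)).
pose I (p : mR * mR) := (\int[ltu N]_t f (fold_rev k (wrap (p, t))))%E.
have mI : measurable_fun [set: mR * mR] I.
  exact: (measurable_fun_fubini_tonelli_F (m2 := ltu N) _ mfwk (fun _ => f0 _)).
have I0 p : (0 <= I p)%E by exact: integral_ge0.
rewrite -ge0_integralZl//=; last 2 first.
- exact: (measurable_fun_fubini_tonelli_F (m2 := mu) I mI I0).
- by move=> x _; apply: integral_ge0 => y _; exact: I0.
apply: eq_integral => x _.
rewrite -ge0_integralZl//=; last first.
- by move=> y _; exact: (I0 (x, y)).
- exact: (measurable_fun_pair2 x mI).
apply: eq_integral => y _.
under eq_integral do rewrite fold_rev_wrap.
apply: (IH N (fun t => f (wrap ((x : R) + k * y, (y : R) + k * x, t)))) => //.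
  by rewrite (leq_trans _ Nn).
exact: (measurableT_comp mfw (pair1_measurable ((x : R) + k * y, (y : R) + k * x))).
Qed.

End tuple_maps.

(** * The Schur-Cohn-Levinson recursion *)

Section monic_poly_algebra.
Variable R : realType.
Local Notation mR := (measurableTypeR R).

Lemma tnth_rcons_max N (t : coeffs R N) (c : mR) :
  tnth (tuple_rcons (t, c)) ord_max = c.
Proof. by rewrite (tnth_nth 0)/= nth_rcons size_tuple ltnn eqxx. Qed.

Lemma tnth_rcons_widen N (t : coeffs R N) (c : mR) i :
  tnth (tuple_rcons (t, c)) (widen_ord (leqnSn N) i) = tnth t i.
Proof.
by rewrite (tnth_nth 0)/= nth_rcons size_tuple ltn_ord -tnth_nth.
Qed.

Lemma monic_poly_rcons N (t : coeffs R N) (c : R) :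
  monic_poly (tuple_rcons (t, c)) = 'X * monic_poly t + c%:P.
Proof.
rewrite /monic_poly big_ord_recr/= subnn expr0 mulrDr -exprS addrA; congr (_ + _).
  congr (_ + _); rewrite big_distrr/=; apply: eq_bigr => i _.
  by rewrite tnth_rcons_widen -scalerAr -exprS subSS -subnSK// ltn_ord.
by rewrite tnth_rcons_max alg_polyC.
Qed.

(* The reciprocal polynomial [x^N P(1/x)]. *)
Definition star N (t : coeffs R N) : {poly R} :=
  1 + 'X * \sum_(i < N) (tnth t i : R) *: 'X^i.

Lemma sum_rev_ord N (t : coeffs R N) :
  \sum_(i < N) (tnth t (rev_ord i) : R) *: 'X^(N - i.+1) =
  \sum_(i < N) (tnth t i : R) *: 'X^i.
Proof.
rewrite (reindex_inj rev_ord_inj)/=; apply: eq_bigr => i _.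
by rewrite rev_ordK subnSK// subKn// ltnW.
Qed.

Lemma monic_poly_fold_rev N k (t : coeffs R N) :
  monic_poly (tuple_rcons (fold_rev k t, k)) = 'X * monic_poly t + k *: star t.
Proof.
rewrite monic_poly_rcons /monic_poly /star.
under eq_bigr do rewrite tnth_mktuple scalerDl.
rewrite big_split/=.
have -> : \sum_(i < N) (k * tnth t (rev_ord i)) *: 'X^(N - i.+1) =
    k *: \sum_(i < N) (tnth t i : R) *: 'X^i.
  by rewrite -sum_rev_ord scaler_sumr; apply: eq_bigr => i _; rewrite scalerA.
rewrite scalerDr alg_polyC scalerAr addrA mulrDr -addrA; congr (_ + _).
by rewrite addrC.
Qed.

Lemma star_fold_rev N k (t : coeffs R N) :
  star (tuple_rcons (fold_rev k t, k)) = star t + k *: ('X * monic_poly t).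
Proof.
rewrite /monic_poly /star big_ord_recr/=.
rewrite tnth_rcons_max.
have -> : \sum_(i < N) tnth (tuple_rcons (fold_rev k t, k)) (widen_ord (leqnSn N) i) *: 'X^i
  = \sum_(i < N) (tnth t i : R) *: 'X^i + k *: \sum_(i < N) (tnth t i : R) *: 'X^(N - i.+1).
  have -> : \sum_(i < N) (tnth t i : R) *: 'X^(N - i.+1) =
      \sum_(i < N) (tnth t (rev_ord i) : R) *: 'X^i :> {poly R}.
    rewrite (reindex_inj rev_ord_inj)/=; apply: eq_bigr => i _.
    by rewrite subnSK// subKn// ltnW.
  rewrite scaler_sumr -big_split/=; apply: eq_bigr => i _.
  rewrite tnth_rcons_widen tnth_mktuple.
  by rewrite scalerDl scalerA.
rewrite -!mul_polyC; ring.
Qed.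

Lemma star_hornerV N (t : coeffs R N) (F : fieldType) (f : {rmorphism R -> F}) (w : F) :
  w != 0 ->
  (map_poly f (star t)).[w] = w ^+ N * (map_poly f (monic_poly t)).[w^-1].
Proof.
move=> w0; rewrite /star /monic_poly !rmorphD rmorph1 rmorphM/= map_polyX !map_polyXn.
rewrite !hornerE !rmorph_sum/= !horner_sum mulrDr -exprMn divff// expr1n.
congr (_ + _); rewrite !big_distrr/=; apply: eq_bigr => i _.
rewrite !linearZ/= !map_polyXn !hornerZ !hornerXn.
rewrite mulrCA [RHS]mulrCA; congr (_ * _).
have E : w ^+ N = w ^+ i.+1 * w ^+ (N - i.+1) by rewrite -exprD subnKC.
by rewrite -exprS exprVn E mulfK// expf_neq0.
Qed.

Lemma size_monic_poly_tail N (t : coeffs R N) :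
  (size (\sum_(i < N) (tnth t i : R) *: 'X^(N - i.+1))%R < size ('X^N : {poly R})%R)%N.
Proof.
rewrite size_polyXn ltnS; apply: (leq_trans (size_sum _ _ _)).
apply/bigmax_leqP => i _; apply: (leq_trans (size_scale_leq _ _)).
by rewrite size_polyXn subnSK// leq_subr.
Qed.

Lemma monic_poly_monic N (t : coeffs R N) : monic_poly t \is monic.
Proof.
by rewrite monicE /monic_poly lead_coefDl ?size_monic_poly_tail// lead_coefXn.
Qed.

Lemma size_monic_poly N (t : coeffs R N) : size (monic_poly t) = N.+1.
Proof. by rewrite /monic_poly size_polyDl ?size_monic_poly_tail// size_polyXn. Qed.

(** The shear is multiplication by x - T read on the non-constant coefficients; differentiating the
    product at [T] leaves only the cofactor. *)
Lemma shear_monic_poly N (T : R) (q : coeffs R N) :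
  let r := 'X * monic_poly (shear T 1 q) in
  [/\ r - r.[T]%:P = ('X - T%:P) * monic_poly q & r^`().[T] = (monic_poly q).[T]].
Proof.
(* The induction bears on the lower-order terms, with a free preceding coefficient; for [prev] equal
   to 1 the term - T x^N completes the leading part to (x - T) x^N. *)
have H prev : exists d : R, 'X * (\sum_(i < N) (tnth (shear T prev q) i : R) *: 'X^(N - i.+1)) =
    ('X - T%:P) * (\sum_(i < N) (tnth q i : R) *: 'X^(N - i.+1)) - (prev * T) *: 'X^N + d%:P.
  elim: N q prev => [|N IH] q prev.
    by exists (prev * T); rewrite !big_ord0 !mulr0 expr0 alg_polyC sub0r addNr.
  have [x [t ->]] : exists x, exists t, q = tuple_cons (x, t).
    by case/tupleP: q => x t; exists x, t; exact: val_inj.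
  have [d dE] := IH t x; exists d.
  rewrite shear_cons !big_ord_recl !tnth0 !subSS !subn0 !mulrDr.
  under eq_bigr do rewrite tnthS subSS.
  rewrite dE; under [in RHS]eq_bigr do rewrite tnthS subSS.
  rewrite exprS -!mul_polyC !rmorphB !rmorphM/=; ring.
move=> r; have [d dE] := H 1.
have rE : r = ('X - T%:P) * monic_poly q + d%:P.
  rewrite /r /monic_poly !mulrDr dE -!mul_polyC; rewrite mul1r; ring.
split; first by rewrite {2}rE rE !hornerE subrr mul0r add0r addrK.
by rewrite rE derivD derivM derivXsubC derivC !hornerE subrr mul0r !addr0.
Qed.

End monic_poly_algebra.

(** * Roots in the closed disc under the recursion *)

Section schur_cohn.
Variable R : realType.
Local Notation mR := (measurableTypeR R).
Local Notation toC := (map_poly (real_complex R)).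

(** The Blaschke estimate: the difference of the squared moduli factors as (|z|^2 - 1) (1 -
    |a|^2). *)
Lemma disc_factor (C : numClosedFieldType) (z a : C) :
  1 <= `|z| -> `|a| <= 1 -> `|1 - a * z^*| <= `|z - a|.
Proof.
move=> z1 a1; rewrite -ler_sqr ?nnegrE// !normCK !rmorphB/= rmorphM/= rmorph1 conjCK.
rewrite -subr_ge0.
have -> : (z - a) * (z^* - a^*) - (1 - a * z^*) * (1 - a^* * z) =
    (z * z^* - 1) * (1 - a * a^*) by ring.
by rewrite -!normCK mulr_ge0// subr_ge0 ?expr_ge1// expr_le1.
Qed.

Lemma conj_real_complex (x : R) : (real_complex R x)^* = real_complex R x.
Proof. by rewrite conj_Creal// complex_real. Qed.

Lemma toC_horner_conj (p : {poly R}) (z : R[i]) : (toC p).[z^*] = (toC p).[z]^*.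
Proof.
rewrite -horner_map/= -map_poly_comp/=; congr horner.
by apply: eq_map_poly => x /=; rewrite conj_real_complex.
Qed.

Lemma monic_poly_split N (t : coeffs R N) :
  exists2 r : seq R[i], size r = N &
    toC (monic_poly t) = \prod_(z <- r) ('X - z%:P).
Proof.
have [r rE] := closed_field_poly_normal (toC (monic_poly t)).
have m := monic_poly_monic t.
rewrite (monicP _) ?map_monic// scale1r in rE.
exists r => //; have := size_monic_poly t.
by rewrite -(size_map_poly (real_complex R)) rE size_prod_XsubC => -[].
Qed.

(** P has real coefficients, so |P*(z)| is also the modulus of P* at the conjugate of z. There P* is
    the product of 1 - a conj(z) over the roots a of P, and [disc_factor] compares it factor by
    factor with P(z). *)
Lemma star_le N (t : coeffs R N) (z : R[i]) : Omega R N t -> 1 <= `|z| ->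
  `|(toC (star t)).[z]| <= `|(toC (monic_poly t)).[z]|.
Proof.
move=> Ot z1; rewrite -norm_conjC -toC_horner_conj.
have z0 : z^* != 0 by rewrite fmorph_eq0 -normr_gt0 (lt_le_trans ltr01).
have [r sr rE] := monic_poly_split t.
rewrite star_hornerV// rE !horner_prod -sr.
have -> : z^* ^+ size r * \prod_(i <- r) ('X - i%:P).[z^*^-1] =
    \prod_(i <- r) (1 - i * z^*).
  elim: (r) => [|x s IH]; first by rewrite !big_nil mulr1.
  rewrite !big_cons exprS mulrACA IH !hornerE mulrBr divff//.
  by rewrite [z^* * x]mulrC.
rewrite !normr_prod big_seq [leRHS]big_seq; apply: ler_prod => i ir.
rewrite normr_ge0 !hornerE disc_factor//; apply: Ot.
by rewrite rE root_prod_XsubC.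
Qed.

(** Up to sign the constant coefficient is the product of the roots. *)
Lemma Omega_rcons_bound N (t : coeffs R N) (k : R) :
  Omega R N.+1 (tuple_rcons (t, k)) -> -1 <= k <= 1.
Proof.
move=> Ot; have [r sr rE] := monic_poly_split (tuple_rcons (t, k)).
have : `|(toC (monic_poly (tuple_rcons (t, k)))).[0]| <= 1.
  rewrite rE horner_prod normr_prod big_seq.
  have h1 : \prod_(i <- r | i \in r) (1 : R[i]) = 1 by rewrite big1.
  rewrite -[leRHS]h1.
  apply: ler_prod => i ir; rewrite hornerXsubC sub0r normrN normr_ge0; apply: Ot.
  by rewrite rE root_prod_XsubC.
rewrite monic_poly_rcons rmorphD rmorphM/= map_polyX map_polyC !hornerE ?mul0r ?add0r.
by rewrite normc_def /= expr0n/= addr0 sqrtr_sqr lecR ler_norml.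
Qed.

(** Let |z| > 1. If z is a root of P, then x P + k P* and its reciprocal take the values k P*(z) and
    P*(z) there; [star_le] for the new polynomial and |k| < 1 force k P*(z) = 0, so z is a root of
    it too. If z is a root of x P + k P*, then |z| |P(z)| = |k| |P*(z)| <= |P(z)| by [star_le] for
    P, whence P(z) = 0. *)
Lemma Omega_fold_rev N (t : coeffs R N) (k : R) : -1 < k < 1 ->
  Omega R N.+1 (tuple_rcons (fold_rev k t, k)) <-> Omega R N t.
Proof.
move=> k1; have kC : `|real_complex R k| < 1.
  by rewrite normc_def /= expr0n/= addr0 sqrtr_sqr ltcR ltr_norml.
have E1 z : (toC (monic_poly (tuple_rcons (fold_rev k t, k)))).[z] =
    z * (toC (monic_poly t)).[z] + real_complex R k * (toC (star t)).[z].
  by rewrite monic_poly_fold_rev rmorphD rmorphM/= map_polyX map_polyZ !hornerE.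
have E2 z : (toC (star (tuple_rcons (fold_rev k t, k)))).[z] =
    (toC (star t)).[z] + real_complex R k * (z * (toC (monic_poly t)).[z]).
  by rewrite star_fold_rev rmorphD/= map_polyZ rmorphM/= map_polyX !hornerE.
have abs0 (w w' : R[i]) : `|w'| <= `|w| -> w = real_complex R k * w' -> w = 0.
  move=> w'w wE; apply/eqP; rewrite -normr_le0.
  have : `|w| * (1 - `|real_complex R k|) <= 0.
    by rewrite mulrBr mulr1 subr_le0 {1}wE normrM mulrC ler_wpM2r.
  by rewrite pmulr_lle0// subr_gt0.
split=> Ot z rz; move: (rz); rewrite rootE => /eqP rz0;
  rewrite real_leNgt ?normr_real ?real1//; apply/negP => z1.
  have := abs0 _ _ (star_le Ot (ltW z1)).
  rewrite E1 E2 rz0 !mulr0 add0r addr0 => /(_ erefl) sz.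
  have zle : `|z| <= 1 by apply: Ot; rewrite rootE E1 rz0 sz !mulr0 addr0.
  by rewrite (le_gtF zle) in z1.
have := star_le Ot (ltW z1); move: rz0; rewrite E1 => rz0 sz.
have z0 : 0 < `|z| by rewrite (lt_trans ltr01).
have h : `|z| * `|(toC (monic_poly t)).[z]| <= `|(toC (monic_poly t)).[z]|.
  rewrite -normrM; move/eqP: rz0; rewrite addr_eq0 => /eqP ->.
  rewrite normrN normrM (le_trans _ sz)// ler_piMl// ltW//.
have M0 : (toC (monic_poly t)).[z] = 0.
  have : (`|z| - 1) * `|(toC (monic_poly t)).[z]| <= 0 by rewrite mulrBl mul1r subr_le0.
  by rewrite pmulr_rle0 ?subr_gt0// normr_le0 => /eqP.
have zle : `|z| <= 1 by apply: Ot; rewrite rootE M0.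
by rewrite (le_gtF zle) in z1.
Qed.

End schur_cohn.

(** * Measurability of the region *)

Section measurable_Omega.
Variable R : realType.
Local Notation mR := (measurableTypeR R).
Local Notation toC := (map_poly (real_complex R)).

Lemma Omega_shear N (T : R) (q : coeffs R N) : -1 <= T <= 1 ->
  Omega R N.+1 (tuple_rcons (shear T 1 q, - ('X * monic_poly (shear T 1 q)).[T])) <->
  Omega R N q.
Proof.
move=> T1; have [E _] := shear_monic_poly T q.
have ME : toC (monic_poly (tuple_rcons (shear T 1 q, - ('X * monic_poly (shear T 1 q)).[T])))
    = ('X - (real_complex R T)%:P) * toC (monic_poly q).
  by rewrite monic_poly_rcons rmorphN E rmorphM/= map_polyXsubC.
split=> Oq z rz; first by apply: Oq; rewrite ME rootM rz orbT.
move: rz; rewrite ME rootM root_XsubC => /orP[/eqP ->|/Oq//].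
by rewrite normc_def /= expr0n/= addr0 sqrtr_sqr lecR ler_norml.
Qed.

(** The coefficients of s^(-N) P(s x), whose roots are those of P divided by s. *)
Definition dilate N (s : R) (t : coeffs R N) : coeffs R N :=
  [tuple (tnth t i : R) / s ^+ i.+1 | i < N].

Lemma monic_poly_dilate N (s : R) (t : coeffs R N) (z : R[i]) : s != 0 ->
  (toC (monic_poly (dilate s t))).[z] =
  (real_complex R s) ^- N * (toC (monic_poly t)).[real_complex R s * z].
Proof.
move=> s0; have s0C : real_complex R s != 0 by rewrite fmorph_eq0.
rewrite /monic_poly !rmorphD/= !map_polyXn !rmorph_sum/=.
rewrite !hornerD !hornerXn !horner_sum mulrDr exprMn mulKf ?expf_neq0//.
congr (_ + _); rewrite big_distrr/=; apply: eq_bigr => i _.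
rewrite tnth_mktuple !linearZ/= !map_polyXn !hornerZ !hornerXn fmorph_div rmorphXn/=.
have E : real_complex R s ^+ N = real_complex R s ^+ i.+1 * real_complex R s ^+ (N - i.+1).
  by rewrite -exprD subnKC.
rewrite E exprMn; field.
by rewrite !expf_neq0.
Qed.

(* Dilating by [s > 1] brings the roots into the open disc, hence the constant term
   into ]-1, 1[, where the recursion applies. *)
Lemma Omega_dilateP N (t : coeffs R N) :
  Omega R N t <-> forall m : nat, Omega R N (dilate (1 + m.+1%:R^-1) t).
Proof.
have s_gt0 m : 0 < 1 + m.+1%:R^-1 :> R by rewrite addr_gt0// invr_gt0.
split=> Ot.
  move=> m z; rewrite rootE monic_poly_dilate ?(gt_eqF (s_gt0 m))//.
  rewrite mulf_eq0 invr_eq0 expf_eq0 fmorph_eq0 (gt_eqF (s_gt0 m)) andbF/= => /Ot.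
  rewrite normrM => h; apply: le_trans h; rewrite ler_peMl//.
  rewrite normc_def /= expr0n/= addr0 sqrtr_sqr lecR gtr0_norm//.
  by rewrite lerDl invr_ge0.
move=> z rz; rewrite real_leNgt ?normr_real ?real1//; apply/negP.
rewrite normc_def; set x := Num.sqrt _; rewrite ltcR => x1.
have [m mx] : exists m : nat, 1 + m.+1%:R^-1 < x.
  exists (Num.bound (x - 1)^-1); rewrite -ltrBrDl invf_plt ?posrE ?subr_gt0//.
  apply: (lt_trans (archi_boundP _)); last by rewrite ltr_nat.
  by rewrite invr_ge0 subr_ge0 ltW.
set s := 1 + _ in mx.
have sne : s != 0 by rewrite gt_eqF// s_gt0.
have sC : real_complex R s != 0 by rewrite fmorph_eq0.
have /Ot : root (toC (monic_poly (dilate s t))) ((real_complex R s)^-1 * z).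
  by rewrite rootE monic_poly_dilate// mulVKf// (rootP rz) mulr0.
rewrite normrM normfV ler_pdivrMl ?normr_gt0// mulr1 [leLHS]normc_def -/x.
rewrite normc_def /= expr0n/= addr0 sqrtr_sqr lecR gtr0_norm ?s_gt0//.
by rewrite leNgt mx.
Qed.

Lemma measurable_dilate N (s : R) : measurable_fun [set: coeffs R N] (dilate s).
Proof.
apply/measurable_fun_tnthP => i.
rewrite (_ : _ \o _ = fun t : coeffs R N => (tnth t i : R) * (s ^+ i.+1)^-1).
  by apply: measurable_funM => //; exact: (measurable_tnth i).
by apply/funext => t /=; rewrite tnth_mktuple.
Qed.

(* Off ]-1, 1[ the junk value 0 replaces the inverse, so that the function is
   measurable on the whole line. *)
Definition inv_one_minus_sqr : R -> R := (fun k : R => (1 - k ^+ 2)^-1 : R) \_ `]-1, 1[.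

Lemma measurable_inv_one_minus_sqr : measurable_fun [set: R] inv_one_minus_sqr.
Proof.
apply/(measurable_restrictT _ (measurable_itv _)).
apply: open_continuous_measurable_fun => //.
move=> k; rewrite inE/= in_itv/= => /andP[k1 k2].
apply: cvgV; first by rewrite gt_eqF//; nra.
by apply: cvgB; [exact: cvg_cst|exact: exprn_continuous].
Qed.

Lemma tuple_rconsE N (t : coeffs R N.+1) :
  tuple_rcons ([tuple tnth t (widen_ord (leqnSn N) i) | i < N], tnth t ord_max) = t.
Proof.
apply: eq_from_tnth => i; have [iN|Ni] := ltnP i N; last first.
  have -> : i = ord_max by apply/val_inj/eqP; rewrite eqn_leq Ni -ltnS ltn_ord.
  by rewrite tnth_rcons_max.
have -> : i = widen_ord (leqnSn N) (Ordinal iN) by exact: val_inj.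
by rewrite tnth_rcons_widen tnth_mktuple.
Qed.

(** The inverse Levinson step, with [[1, k], [k, 1]] inverted on each mirror pair. The same
    expression covers a middle coordinate, as (1 - k) / (1 - k^2) = 1 / (1 + k). *)
Definition unfold_rev N (t : coeffs R N.+1) : coeffs R N :=
  let k : R := tnth t ord_max in
  [tuple ((tnth t (widen_ord (leqnSn N) i) : R)
          - k * tnth t (widen_ord (leqnSn N) (rev_ord i))) * inv_one_minus_sqr k | i < N].

Lemma unfold_revK N (t : coeffs R N.+1) : `|(tnth t ord_max : R)| < 1 ->
  tuple_rcons (fold_rev (tnth t ord_max) (unfold_rev t), tnth t ord_max) = t.
Proof.
rewrite ltr_norml => k1; rewrite -[RHS]tuple_rconsE; congr (tuple_rcons (_, _)).
apply: eq_from_tnth => i; rewrite !tnth_mktuple rev_ordK.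
rewrite /inv_one_minus_sqr patchE mem_set/= ?in_itv/= ?k1//; field.
by have /andP[? ?] := k1; rewrite gt_eqF//; nra.
Qed.

Lemma measurable_unfold_rev N : measurable_fun [set: coeffs R N.+1] (@unfold_rev N).
Proof.
apply/measurable_fun_tnthP => i.
rewrite (_ : _ \o _ = fun t : coeffs R N.+1 =>
    ((tnth t (widen_ord (leqnSn N) i) : R)
     - (tnth t ord_max : R) * tnth t (widen_ord (leqnSn N) (rev_ord i)))
    * inv_one_minus_sqr (tnth t ord_max)).
  apply: measurable_funM; last first.
    apply: (measurableT_comp measurable_inv_one_minus_sqr).
    exact: (measurable_tnth ord_max).
  apply: measurable_funB; first exact: measurable_tnth.
  by apply: measurable_funM; exact: measurable_tnth.
by apply/funext => t /=; rewrite tnth_mktuple.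
Qed.

(** Where the constant coefficient has modulus less than 1, the region is the preimage under
    [unfold_rev] of the region one degree lower. *)
Lemma measurable_Omega N : measurable (Omega R N).
Proof.
elim: N => [|N IH].
  rewrite (_ : Omega R 0 = setT); first exact: measurableT.
  apply/seteqP; split=> // t _ z.
  by rewrite /monic_poly big_ord0 addr0 expr0 rmorph1 (negbTE (root1 _)).
pose B : set (coeffs R N.+1) := [set t | `|(tnth t ord_max : R)| < 1].
have mB : measurable B.
  rewrite (_ : B = (fun t : coeffs R N.+1 => tnth t ord_max) @^-1` `]-1, 1[).
    rewrite -[X in measurable X]setTI.
    by apply: (measurable_tnth ord_max) => //; exact: measurable_itv.
  by apply/seteqP; split=> t; rewrite /B/= ltr_norml in_itv.
have mBO : measurable (B `&` Omega R N.+1).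
  rewrite (_ : _ `&` _ = B `&` @unfold_rev N @^-1` Omega R N).
    apply: measurableI => //; rewrite -[X in measurable X]setTI.
    exact: measurable_unfold_rev.
  have k1 (t : coeffs R N.+1) : B t -> -1 < (tnth t ord_max : R) < 1.
    by rewrite /B/= ltr_norml.
  apply/seteqP; split=> t [Bt]; have := unfold_revK Bt => tE.
    by rewrite -[X in Omega R N.+1 X]tE => /(Omega_fold_rev _ (k1 _ Bt)).
  by move=> /(Omega_fold_rev _ (k1 _ Bt)); rewrite tE.
(* A constant coefficient of modulus 1 escapes the recursion; each dilation in the sequence brings
   it strictly inside. *)
rewrite (_ : Omega R N.+1 =
    \bigcap_m (dilate (1 + m.+1%:R^-1) @^-1` (B `&` Omega R N.+1))).
  apply: bigcap_measurable => // m _.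
  by rewrite -[X in measurable X]setTI; exact: measurable_dilate.
have s_gt1 m : 1 < 1 + m.+1%:R^-1 :> R by rewrite ltrDl invr_gt0.
apply/seteqP; split=> t Ot; last first.
  by apply/Omega_dilateP => m; have [] := Ot m I.
move=> m _; split; last by have /Omega_dilateP := Ot.
rewrite /B/= tnth_mktuple normrM normfV.
rewrite ltr_pdivrMr ?normr_gt0 ?expf_neq0 ?gt_eqF ?(lt_trans _ (s_gt1 m))// mul1r.
have : Omega R N.+1 (tuple_rcons
    ([tuple tnth t (widen_ord (leqnSn N) i) | i < N], tnth t ord_max)).
  by rewrite tuple_rconsE.
move=> /Omega_rcons_bound kb.
apply: (@le_lt_trans _ _ 1); first by rewrite ler_norml.
by rewrite normrX exprn_egt1// gtr0_norm (s_gt1, lt_trans ltr01 (s_gt1 m)).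
Qed.

End measurable_Omega.

(** * The ratio of consecutive volumes *)

Section volume_ratio.
Variable R : realType.
Local Notation mu := (@lebesgue_measure R).
Local Notation ltu := (lebesgue_tuple R).
Local Notation mR := (measurableTypeR R).

(* ['C(2n, n) / 4^n], the coefficient of [x^n] in [(1 - x)^(-1/2)] *)
Definition cbin (n : nat) : R := 'C(2 * n, n)%:R / 4 ^+ n.

Lemma cbin0 : cbin 0 = 1.
Proof. by rewrite /cbin muln0 bin0 expr0 divr1. Qed.

Lemma cbin_gt0 n : 0 < cbin n.
Proof. by rewrite divr_gt0 ?exprn_gt0// ltr0n bin_gt0 mul2n -addnn leq_addr. Qed.

Lemma cbinS n : cbin n.+1 = cbin n * (2 * n + 1)%:R / (2 * n + 2)%:R.
Proof.
have h : ((n.+1 * n.+1) * 'C(2 * n.+1, n.+1) = (2 * n + 2) * ((2 * n + 1) * 'C(2 * n, n)))%N.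
  have -> : (2 * n.+1 = (2 * n + 1).+1)%N by lia.
  rewrite -mulnA -mul_bin_diag mulnCA; congr (_ * _)%N; first by lia.
  have -> : ('C(2 * n + 1, n) = 'C((2 * n).+1, n.+1))%N.
    rewrite -(@bin_sub _ n); last by lia.
    by congr binomial; lia.
  by rewrite -mul_bin_diag addn1.
have {}h : (n.+1 * n.+1)%:R * 'C(2 * n.+1, n.+1)%:R =
    (2 * n + 2)%:R * ((2 * n + 1)%:R * 'C(2 * n, n)%:R) :> R.
  by rewrite -!natrM h.
have n0 : (n.+1 * n.+1)%:R != 0 :> R by rewrite pnatr_eq0.
have -> : cbin n.+1 = ((n.+1 * n.+1)%:R * 'C(2 * n.+1, n.+1)%:R) / (n.+1 * n.+1)%:R / 4 ^+ n.+1.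
  by rewrite /cbin [X in _ = X / _ ^+ _]mulrAC divff// mul1r.
rewrite h /cbin exprS !(natrM, natrD, =^~ natr1).
field.
by rewrite expf_neq0// natr1 pnatr_eq0/= -!natrM -!natrD !pnatr_eq0; lia.
Qed.

(* The primitive of [(1 - x^2)^j] obtained by integrating by parts. *)
Fixpoint beta_prim (j : nat) : {poly R} :=
  if j is i.+1 then
    (2 * j + 1)%:R^-1 *: ('X * (1 - 'X ^+ 2) ^+ j + (2 * j)%:R *: beta_prim i)
  else 'X.

Lemma beta_primE j : (beta_prim j)^`() = (1 - 'X ^+ 2) ^+ j.
Proof.
elim: j => [|j IH] /=; first by rewrite derivX expr0.
rewrite derivZ derivD derivZ IH derivM derivX deriv_exp derivB derivXn derivC/=.
have j0 : (2 * j.+1 + 1)%:R != 0 :> R by rewrite pnatr_eq0 addn1.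
apply: (scalerI j0); rewrite scalerA divff// scale1r.
rewrite exprS -!mul_polyC !rmorph_nat.
by rewrite -mulr_natr expr1 -[_ *+ 2]mulr_natr !natrD !natrM; ring.
Qed.

Lemma beta_prim_bounds j :
  (beta_prim j).[1] - (beta_prim j).[-1] = 2 / ((2 * j + 1)%:R * cbin j).
Proof.
elim: j => [|j IH]; first by rewrite cbin0 !hornerE; field.
rewrite cbinS; move: IH (cbin_gt0 j); move: (cbin j) => c IH c0.
rewrite [beta_prim _]/= !hornerE sqrrN expr1n subrr expr0n/=.
rewrite mulr0 !add0r -!mulrBr IH.
have j1 : (2 * j + 1)%:R != 0 :> R by rewrite pnatr_eq0 addn1.
have j2 : (2 * j + 2)%:R != 0 :> R by rewrite pnatr_eq0 addn2.
have j3 : (2 * j.+1 + 1)%:R != 0 :> R by rewrite pnatr_eq0 addn1.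
have -> : (2 * j.+1 = 2 * j + 2)%N by lia.
have {}j3 : (2 * j + 2 + 1)%:R != 0 :> R by rewrite pnatr_eq0 addn1.
move: j1 j2 j3; move: (_ + 1)%:R (_ + 2)%:R (_ + 2 + 1)%:R => x y z x0 y0 z0.
by field; rewrite x0 y0 z0 gt_eqF.
Qed.

Lemma measurable_fold_rev_jacobian N (A : set R) :
  measurable_fun A (@fold_rev_jacobian R N).
Proof.
rewrite (_ : @fold_rev_jacobian R N =
    horner ((1 - 'X ^+ 2) ^+ N./2 * (1 + 'X) ^+ odd N)).
  exact: measurable_poly.
by apply/funext => k; rewrite /fold_rev_jacobian !hornerE.
Qed.

(** For odd [N] the factor 1 + k contributes the additional term k (1 - k^2)^j, whose primitive - (1
    - k^2)^(j+1) / (2 (j + 1)) vanishes at both endpoints. *)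
Lemma integral_jacobian N :
  (\int[mu]_(k in `](-1)%R, 1%R[) (fold_rev_jacobian N k)%:E =
   (2 / ((2 * N./2 + 1)%:R * cbin N./2))%:E)%E.
Proof.
pose p := beta_prim N./2 -
  (odd N)%:R *: ((2 * N./2.+1)%:R^-1 *: (1 - 'X ^+ 2) ^+ N./2.+1) : {poly R}.
have pE k : p^`().[k] = fold_rev_jacobian N k.
  have N1 : (2 * N./2.+1)%:R != 0 :> R by rewrite pnatr_eq0.
  rewrite /p derivB beta_primE !derivZ deriv_exp derivB derivXn derivC/=.
  rewrite /fold_rev_jacobian expr1 !(hornerE, hornerMn) -(mulr_natr _ N./2.+1).
  move: N1; rewrite natrM; move: ((1 - k ^+ 2) ^+ N./2) (N./2.+1%:R) => c n.
  rewrite mulf_eq0 negb_or => /andP[_ n0].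
  by case: (odd N); rewrite /= ?expr0 ?expr1; field.
rewrite -(@integral_itv_bndoo _ _ _ _ false false); last first.
  by apply/measurable_EFinP; exact: measurable_fold_rev_jacobian.
under eq_integral do rewrite -pE.
have N11 : -1 < 1 :> R by lra.
rewrite (integral_deriv_poly p N11).
congr EFin; rewrite -beta_prim_bounds /p !hornerE sqrrN expr1n subrr expr0n/=.
by rewrite !mulr0 !subr0.
Qed.

(** Slicing by the constant coefficient c: for |c| < 1 the slice is the image of the region one
    degree lower under [fold_rev c], for |c| > 1 it is empty, and the two values of modulus 1 form a
    null set. *)
Lemma Omega_volumeS N : Omega_volume R N.+1 =
  ((2 / ((2 * N./2 + 1)%:R * cbin N./2))%:E * Omega_volume R N)%E.
Proof.
have mO := @measurable_Omega R.
pose f (t : coeffs R N.+1) : \bar R := (\1_(Omega R N.+1) t)%:E.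
have mf : measurable_fun [set: coeffs R N.+1] f.
  by apply/measurable_EFinP; apply: measurable_indic; exact: mO.
have f0 t : (0 <= f t)%E by rewrite lee_fin.
have -> : Omega_volume R N.+1 = (\int[ltu N.+1]_t f t)%E.
  by rewrite /f integral_indic ?setIT//; exact: mO.
have mfr := measurableT_comp mf (@measurable_tuple_rcons R N).
rewrite integral_tuple_rcons// (@fubini_tonelli _ _ _ _ R (ltu N) mu _ mfr (fun _ => f0 _)).
have slice (c : R) : -1 < c < 1 -> (\int[ltu N]_t f (tuple_rcons (t, c)) =
    (fold_rev_jacobian N c)%:E * Omega_volume R N)%E.
  move=> c1; have mfc : measurable_fun [set: coeffs R N] (fun t => f (tuple_rcons (t, c))).
    exact: (measurableT_comp mfr (pair2_measurable (c : mR))).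
  rewrite -(integral_fold_rev c1 mfc)//; congr (_ * _)%E.
  rewrite /Omega_volume -[X in _ = lebesgue_tuple _ _ X]setIT.
  rewrite -integral_indic//; last exact: mO.
  apply: eq_integral => t _; rewrite /f !indicE; congr (nat_of_bool _)%:R%:E.
  by apply/idP/idP; rewrite !inE => /(Omega_fold_rev t c1).
have outside (c : R) : ~~ (-1 <= c <= 1) -> (\int[ltu N]_t f (tuple_rcons (t, c)) = 0)%E.
  move=> c1; apply: integral0_eq => t _; rewrite /f indicE memNset//.
  by move=> /Omega_rcons_bound; exact/negP.
rewrite -integral_jacobian.
have mF : measurable_fun [set: mR] (fun c => \int[ltu N]_t f (tuple_rcons (t, c)))%E.
  exact: (measurable_fun_fubini_tonelli_G (m1 := ltu N) _ mfr (fun _ => f0 _)).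
transitivity (\int[mu]_(c in `[(-1)%R, 1%R]) \int[ltu N]_t f (tuple_rcons (t, c)))%E.
  rewrite [RHS]integral_mkcond; apply: eq_integral => c _.
  rewrite patchE; case: ifPn => // c1; apply: outside.
  by move: c1; rewrite notin_setE/= in_itv/= => /negP.
rewrite (@integral_itv_bndoo _ _ _ _ true false); last exact: measurable_funTS.
rewrite -ge0_integralZr//=.
- by apply: eq_integral => c; rewrite inE/= in_itv/= => c1; exact: slice.
- by apply/measurable_EFinP; exact: measurable_fold_rev_jacobian.
- move=> c; rewrite in_itv/= => /andP[c1 c2]; rewrite lee_fin.
  by rewrite mulr_ge0 ?exprn_ge0//; nra.
Qed.

End volume_ratio.
Arguments cbin : simpl never.

(** * Counting zeros *)

Section measurable_zeros.
Variable R : realType.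
Local Notation mR := (measurableTypeR R).

Lemma monic_poly_horner N (t : coeffs R N) (x : R) :
  (monic_poly t).[x] = x ^+ N + \sum_(i < N) (tnth t i : R) * x ^+ (N - i.+1).
Proof.
rewrite /monic_poly hornerD hornerXn horner_sum; congr (_ + _).
by apply: eq_bigr => i _; rewrite hornerZ hornerXn.
Qed.

Lemma measurable_monic_poly_horner N d (X : measurableType d) (x : X -> R)
    (t : X -> coeffs R N) :
  measurable_fun [set: X] x -> measurable_fun [set: X] t ->
  measurable_fun [set: X] (fun w => (monic_poly (t w)).[x w]).
Proof.
move=> mx mt; under eq_fun do rewrite monic_poly_horner.
apply: measurable_funD; first exact: measurable_funX.
apply: measurable_sum => i; apply: measurable_funM; last exact: measurable_funX.
exact: (measurableT_comp (measurable_tnth i)).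
Qed.

Definition has_zero N (u v : R) : set (coeffs R N) :=
  [set t | exists2 x, u <= x <= v & root (monic_poly t) x].

(* [Num.max u (Num.min v (ratr r))] runs over a countable dense subset of [u, v]. *)
Lemma has_zeroE N u v : u <= v -> @has_zero N u v =
  \bigcap_m \bigcup_r [set t | `|(monic_poly t).[Num.max u (Num.min v (ratr r))]| < m.+1%:R^-1].
Proof.
move=> uv; apply/seteqP; split=> t.
  move=> [x /andP[ux xv] rx] m _.
  have [xv'|vx] := ltP x v; last first.
    (* A zero at the right endpoint is hit exactly: a rational beyond [v] is clipped to [v]. *)
    have [r] := rat_in_itvoo (ltr_pwDr ltr01 (lexx v)).
    rewrite in_itv/= => /andP[vr _]; exists r => //=.
    rewrite (min_idPl (ltW vr)) (max_idPr uv).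
    have -> : v = x by apply/eqP; rewrite eq_le vx xv.
    by rewrite (rootP rx) normr0 invr_gt0.
  have m0 : 0 < m.+1%:R^-1 :> R by rewrite invr_gt0.
  have /(_ (ball 0 m.+1%:R^-1)) := @continuous_horner R (monic_poly t) x.
  rewrite (rootP rx) => /(_ (nbhsx_ballx _ _ m0))/nbhs_ballP[d /= d0 dx].
  have [r] : exists r : rat, ratr r \in `]x, (Num.min v (x + d))[.
    have /rat_in_itvoo[r rI] : x < Num.min v (x + d) by rewrite lt_min xv' ltrDl.
    by exists r.
  rewrite in_itv/= lt_min => /andP[xr /andP[rv rd]]; exists r => //=.
  rewrite (min_idPr (ltW rv)) (max_idPr (le_trans ux (ltW xr))).
  have := dx (ratr r); rewrite /ball/= sub0r normrN; apply.
  by rewrite ltr0_norm ?subr_lt0// opprB ltrBlDl.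
move=> h; have cp : {within `[u, v], continuous (fun x => `|(monic_poly t).[x]|)}.
  apply: continuous_subspaceT => x; apply: cvg_norm; exact: continuous_horner.
have [c cuv cmin] := EVT_min uv cp.
exists c; first by move: cuv; rewrite in_itv.
rewrite rootE -normr_eq0 eq_le normr_ge0 andbT leNgt; apply/negP => c0.
pose m := Num.bound `|(monic_poly t).[c]|^-1.
have mc : m.+1%:R^-1 < `|(monic_poly t).[c]|.
  rewrite invf_plt ?posrE//; apply: (lt_trans (archi_boundP _)).
    by rewrite invr_ge0.
  by rewrite ltr_nat.
have [r _ /= rm] := h m I.
have /cmin : Num.max u (Num.min v (ratr r)) \in `[u, v].
  by rewrite in_itv/= le_max lexx/= ge_max uv ge_min lexx.
by rewrite leNgt (lt_trans rm mc).
Qed.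

Lemma measurable_has_zero N u v : measurable (@has_zero N u v).
Proof.
have [vu|uv] := ltP v u.
  rewrite (_ : has_zero _ _ = set0) ?measurable0//.
  apply/seteqP; split=> // t [x /andP[ux xv]]; have := le_trans ux xv.
  by rewrite leNgt vu.
rewrite has_zeroE//; apply: bigcap_measurable => // m _.
apply: bigcupT_measurable_rat => r.
rewrite -[X in measurable X]setTI.
have mf : measurable_fun [set: coeffs R N]
    (fun t => `|(monic_poly t).[Num.max u (Num.min v (ratr r))]|).
  apply: measurableT_comp => //; exact: measurable_monic_poly_horner.
have := measurable_fun_ltr mf (measurable_cst (m.+1%:R^-1 : R)).
move=> /(_ measurableT [set true]); rewrite !setTI; apply.
by [].
Qed.

Definition zeros N (t : coeffs R N) (u v : R) : set R :=
  [set x | u <= x <= v /\ root (monic_poly t) x].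

Lemma finite_zeros N (t : coeffs R N) u v : finite_set (zeros t u v).
Proof.
apply: (@sub_finite_set _ _ [set` polyrcf.roots (monic_poly t) (u - 1) (v + 1)]).
  move=> x [/andP[ux xv] rx] /=.
  rewrite polyrcf.in_roots rx monic_neq0 ?monic_poly_monic// in_itv/= andbT.
  by rewrite ltrBlDr (le_lt_trans ux) ?ltrDl//= (le_lt_trans xv)// ltrDl.
exact: finite_seq.
Qed.

Lemma mem_zeros N (t : coeffs R N) u v x :
  (x \in fset_set (zeros t u v)) = (u <= x <= v) && root (monic_poly t) x.
Proof.
rewrite in_fset_set; last exact: finite_zeros.
by apply/idP/andP; rewrite inE.
Qed.

Lemma nb_zeros_le N (t : coeffs R N) u v : (nb_zeros u v t <= N)%N.
Proof.
rewrite -ltnS -(size_monic_poly t); apply: max_poly_roots.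
- exact/monic_neq0/monic_poly_monic.
- by apply/allP => x; rewrite -/(zeros t u v) mem_zeros => /andP[].
- exact: fset_uniq.
Qed.

Lemma nb_zeros_gt0 N (t : coeffs R N) u v : (0 < nb_zeros u v t)%N <-> has_zero u v t.
Proof.
rewrite /nb_zeros cardfs_gt0 -/(zeros t u v); split=> [/fset0Pn[x]|[x uxv rx]].
  by rewrite mem_zeros => /andP[]; exists x.
by apply/fset0Pn; exists x; rewrite mem_zeros uxv.
Qed.

(** A rational gap between the two smallest zeros turns the count into countable unions, as
    measurability requires. Since [k] is positive, some zero lies in [r, v], which keeps the zero
    found in [u, s] below [v]. *)
Lemma nb_zeros_gtS N (t : coeffs R N) u v k : (0 < k)%N ->
  (k < nb_zeros u v t)%N <->
  exists s r : rat, [/\ ratr s < ratr r :> R, has_zero u (ratr s) t &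
                        (k <= nb_zeros (ratr r) v t)%N].
Proof.
move=> k0; split; last first.
  move=> [s [r [sr [x /andP[ux xs] rx] kr]]]; apply: (leq_ltn_trans kr).
  have [y /andP[ry yv] _] : has_zero (ratr r) v t.
    by apply/nb_zeros_gt0; exact: leq_trans kr.
  have xr := le_lt_trans xs sr.
  rewrite /nb_zeros -!/(zeros t _ _).
  apply: (@leq_trans #|` (x |` fset_set (zeros t (ratr r) v))%fset|).
    rewrite cardfsU1 mem_zeros !negb_and -ltNge xr/= add1n.
    by [].
  apply/fsubset_leq_card/fsubsetP => z; rewrite !inE !mem_zeros.
  move=> /orP[/eqP ->|/andP[/andP[rz ->] ->]]; last first.
    by rewrite andbT (le_trans ux (le_trans (ltW xr) rz)).
  by rewrite rx ux (le_trans (ltW xr) (le_trans ry yv)).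
rewrite /nb_zeros -!/(zeros t _ _).
set E := fset_set (zeros t u v).
have : sorted <%R (sort <=%R (enum_fset E)).
  by rewrite sort_lt_sorted fset_uniq.
have szE : size (sort <=%R (enum_fset E)) = #|` E| by rewrite size_sort.
have memE x : (x \in sort <=%R (enum_fset E)) = (x \in E) by rewrite mem_sort.
case: (sort _ _) szE memE => [<-//|z1 [|z2 l]] szE memE; rewrite -szE//=.
  by rewrite ltnS leqNgt k0.
move=> /andP[z12 z2l] kl.
have z2P x : x \in E -> x != z1 -> z2 <= x.
  rewrite -memE !inE => /or3P[/eqP ->|/eqP ->//|xl _]; first by rewrite eqxx.
  by move: z2l; rewrite lt_path_sortedE => /andP[/allP/(_ _ xl)/ltW].
have [s] := rat_in_itvoo z12; rewrite in_itv/= => /andP[z1s sz2].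
have [r] := rat_in_itvoo sz2; rewrite in_itv/= => /andP[sr rz2].
exists s, r; split=> //.
  have : z1 \in E by rewrite -memE mem_head.
  rewrite mem_zeros => /andP[/andP[uz1 z1v] rz1]; exists z1 => //.
  by rewrite uz1 ltW.
apply: (@leq_trans #|` (E `\ z1)%fset|).
  have := cardfsD1 z1 E; rewrite -memE mem_head -szE add1n => -[<-].
  by rewrite -ltnS.
apply/fsubset_leq_card/fsubsetP => x; rewrite in_fsetD1 => /andP[xz1 xE].
have := xE; rewrite !mem_zeros => /andP[/andP[_ ->] ->]; rewrite !andbT.
by rewrite (le_trans (ltW rz2))// z2P.
Qed.

Lemma measurable_nb_zeros_gt N k u v :
  measurable [set t : coeffs R N | (k < nb_zeros u v t)%N].
Proof.
elim: k u => [|k IH] u.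
  rewrite (_ : [set _ | _] = has_zero u v); first exact: measurable_has_zero.
  by apply/seteqP; split=> t /nb_zeros_gt0.
rewrite (_ : [set _ | _] = \bigcup_(s in [set: rat]) \bigcup_(r in [set: rat])
  ([set t | ratr s < ratr r :> R] `&` has_zero u (ratr s)
     `&` [set t | (k < nb_zeros (ratr r) v t)%N])).
  apply: bigcupT_measurable_rat => s; apply: bigcupT_measurable_rat => r.
  apply: measurableI => //; apply: measurableI; last exact: measurable_has_zero.
  have [sr|sr] := pselect (ratr s < ratr r :> R).
    rewrite (_ : [set t | _] = setT); first exact: measurableT.
    by apply/seteqP; split.
  rewrite (_ : [set t | _] = set0); first exact: measurable0.
  by apply/seteqP; split.
apply/seteqP; split=> t.
  by move=> /(nb_zeros_gtS _ _ _ (ltn0Sn k))[s [r [sr zs kr]]]; exists s => //; exists r.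
by move=> [s _ [r _ [[/= sr zs] kr]]]; apply/nb_zeros_gtS => //; exists s, r.
Qed.

Lemma measurable_nb_zeros N u v (A : set (coeffs R N)) :
  measurable_fun A (fun t : coeffs R N => (nb_zeros u v t)%:R : R).
Proof.
apply: measurable_funTS.
rewrite (_ : (fun _ => _) = fun t =>
    \sum_(k < N) \1_[set t : coeffs R N | (k < nb_zeros u v t)%N] t).
  apply: measurable_sum => k; apply: measurable_indic.
  exact: measurable_nb_zeros_gt.
apply/funext => t.
have E (k : 'I_N) : (t \in [set t : coeffs R N | (k < nb_zeros u v t)%N]) =
    (k < nb_zeros u v t)%N by apply/idP/idP; rewrite inE.
under eq_bigr do rewrite indicE E.
rewrite -natr_sum; congr (_%:R).
have := nb_zeros_le t u v; move: (nb_zeros _ _ _) => n nN.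
rewrite -[LHS]card_ord -sum1_card (big_ord_widen _ (fun=> 1%N) nN) [LHS]big_mkcond/=.
by apply: eq_bigr => i _; case: (i < n)%N.
Qed.

End measurable_zeros.

(** * The expected number of zeros as an integral over the position of a zero *)

Section zeros_identity.
Variable R : realType.
Local Notation mu := (@lebesgue_measure R).
Local Notation ltu := (lebesgue_tuple R).
Local Notation mR := (measurableTypeR R).

Lemma deriv_mulX_monic_poly_neq0 N (t : coeffs R N) : ('X * monic_poly t)^`() != 0.
Proof.
have /monicP : 'X * monic_poly t \is monic.
  by rewrite monicMl ?monicX// monic_poly_monic.
have M0 := monic_neq0 (monic_poly_monic t).
rewrite lead_coefE [in size _]mulrC size_mulX// size_monic_poly/= => h.
apply/eqP => /(congr1 (fun p : {poly R} => p`_N)); rewrite coef_deriv h coef0.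
by apply/eqP; rewrite pnatr_eq0.
Qed.

Lemma measurable_deriv_horner N :
  measurable_fun [set: mR * coeffs R N] (fun p => ('X * monic_poly p.2)^`().[p.1 : R]).
Proof.
under eq_fun do rewrite derivM derivX mul1r hornerD hornerM hornerX.
apply: measurable_funD; first exact: measurable_monic_poly_horner.
apply: measurable_funM => //.
have E (p : mR * coeffs R N) : (monic_poly p.2)^`().[p.1 : R] =
    (p.1 : R) ^+ N.-1 *+ N +
    \sum_(i < N) (tnth p.2 i : R) * ((p.1 : R) ^+ (N - i.+1).-1 *+ (N - i.+1)).
  rewrite /monic_poly derivD derivXn hornerD hornerMn hornerXn raddf_sum/= horner_sum.
  congr (_ + _); apply: eq_bigr => i _.
  by rewrite derivZ derivXn hornerZ hornerMn hornerXn.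
under eq_fun do rewrite E.
apply: measurable_funD; first by under eq_fun do rewrite -mulr_natr;
  apply: measurable_funM => //; exact: measurable_funX.
apply: measurable_sum => i; apply: measurable_funM.
  by apply: (measurableT_comp (measurable_tnth i)); exact: measurable_snd.
under eq_fun do rewrite -mulr_natr.
by apply: measurable_funM => //; exact: measurable_funX.
Qed.

Lemma measurable_mean_horner N : measurable_fun [set: mR]
  (fun T : mR => \int[ltu N]_(q in Omega R N) `|(monic_poly q).[T : R]|%:E)%E.
Proof.
pose g (p : mR * coeffs R N) : \bar R :=
  (\1_(Omega R N) p.2 * `|(monic_poly p.2).[p.1 : R]|)%:E.
have mg : measurable_fun [set: mR * coeffs R N] g.
  apply/measurable_EFinP; apply: measurable_funM.
    apply: (measurableT_comp _ measurable_snd).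
    by apply: measurable_indic; exact: measurable_Omega.
  by apply: measurableT_comp => //; exact: measurable_monic_poly_horner.
have g0 p : (0 <= g p)%E by rewrite lee_fin mulr_ge0.
have := measurable_fun_fubini_tonelli_F (m2 := ltu N) g mg g0.
congr measurable_fun; apply/funext => T; rewrite [RHS]integral_mkcond.
apply: eq_integral => q _; rewrite patchE /g/= indicE.
by case: ifPn => _; rewrite ?mul1r ?mul0r.
Qed.

Variables (N : nat) (u v : R).

(* The polynomial of [pin T t] is ['X * monic_poly t] shifted so as to vanish at [T]. *)
Let pin (T : mR) (t : coeffs R N) : coeffs R N.+1 :=
  tuple_rcons (t, - ('X * monic_poly t).[T] : mR).

Let measurable_pin : measurable_fun [set: mR * coeffs R N] (fun p => pin p.1 p.2).
Proof.
apply: (measurableT_comp (@measurable_tuple_rcons R N)).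
apply: measurable_fun_pair; first exact: measurable_snd.
apply: measurableT_comp => //; under eq_fun do rewrite hornerM hornerX.
apply: measurable_funM => //; exact: measurable_monic_poly_horner.
Qed.

Let w (a : coeffs R N.+1) : \bar R := (\1_(Omega R N.+1) a * (nb_zeros u v a)%:R)%:E.

Let measurable_w : measurable_fun [set: coeffs R N.+1] w.
Proof.
apply/measurable_EFinP; apply: measurable_funM; last exact: measurable_nb_zeros.
by apply: measurable_indic; exact: measurable_Omega.
Qed.

Let w_ge0 a : (0 <= w a)%E. Proof. by rewrite lee_fin mulr_ge0. Qed.

Let dens (T : R) (t : coeffs R N) : \bar R :=
  (\1_(Omega R N.+1) (pin T t) * `|('X * monic_poly t)^`().[T]|)%:E.

Let measurable_dens : measurable_fun [set: mR * coeffs R N] (fun p => dens p.1 p.2).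
Proof.
apply/measurable_EFinP; apply: measurable_funM.
  apply: measurableT_comp measurable_pin.
  by apply: measurable_indic; exact: measurable_Omega.
by apply: measurableT_comp => //; exact: measurable_deriv_horner.
Qed.

Let dens_ge0 T t : (0 <= dens T t)%E.
Proof. by rewrite lee_fin mulr_ge0. Qed.

(** The zeros of r + c are the solutions of - r(T) = c, so integrating their number over c is the
    area formula for - r. The condition that r + c lie in [Omega] becomes the set [A] of admissible
    T. *)
Let slice (t : coeffs R N) : u <= v ->
  (\int[mu]_c w (tuple_rcons (t, c)) = \int[mu]_(T in `]u, v]) dens T t)%E.
Proof.
move=> uv; set r := 'X * monic_poly t.
pose A : set R := [set T | Omega R N.+1 (pin T t)].
have mA : measurable A.
  rewrite -[X in measurable X]setTI.
  have mpt : measurable_fun [set: mR] (fun T => pin T t).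
    exact: (measurableT_comp measurable_pin (pair2_measurable t)).
  exact: (mpt measurableT _ (@measurable_Omega R N.+1)).
have p0 : (- r)^`() != 0 by rewrite derivN oppr_eq0 deriv_mulX_monic_poly_neq0.
have [mc cE] := area_formula_poly p0 uv mA.
transitivity (\int[mu]_c counting (fiber (- r) u v A c))%E; last first.
  rewrite cE integral_mkcondl; apply: eq_integral => T _.
  rewrite patchE /dens -/r derivN hornerN normrN indicE.
  have -> : (pin T t \in Omega R N.+1) = (T \in A) by apply/idP/idP; rewrite !inE.
  by case: ifPn => _; rewrite ?mul1r ?mul0r.
apply: ge0_ae_eq_integral => //.
- apply: (measurableT_comp measurable_w).
  exact: (measurableT_comp (@measurable_tuple_rcons R N) (pair1_measurable t)).
(* Only for this value of c is [u] a zero, counted by [nb_zeros] but not by the fibre over the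
   half-open interval. *)
- exists [set - r.[u]]; split => //; first exact: lebesgue_measure_set1.
  move=> c /= h; apply: contrapT => cu; apply: h => _.
  rewrite /w indicE.
  have rc x : root (monic_poly (tuple_rcons (t, c))) x = ((- r).[x] == c).
    rewrite rootE monic_poly_rcons -/r hornerD hornerC hornerN.
    by rewrite addr_eq0 eqr_oppLR.
  have fE : fiber (- r) u v A c =
      [set x | Omega R N.+1 (tuple_rcons (t, c))] `&` zeros (tuple_rcons (t, c)) u v.
    apply/seteqP; split=> x.
      move=> [[Ax /=]]; rewrite in_itv/= => /andP[ux xv] xc; split=> /=.
        by move: Ax; rewrite /A/= /pin -/r -hornerN xc.
      by rewrite /zeros/= rc xc eqxx (ltW ux) xv.
    move=> [/= Oc [/andP[ux xv]]]; rewrite rc => /eqP xc; split=> //; split.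
      by rewrite /A/= /pin -/r -hornerN xc.
    rewrite /= in_itv/= xv andbT lt_neqAle ux andbT.
    by apply/eqP => uE; apply: cu; rewrite -xc -uE hornerN.
  rewrite fE; have [Oc|Oc] := pselect (Omega R N.+1 (tuple_rcons (t, c))).
    rewrite mem_set// mul1r (_ : [set _ | _] `&` _ = zeros (tuple_rcons (t, c)) u v).
      by rewrite /counting asboolT//; exact: finite_zeros.
    by apply/seteqP; split=> // x [].
  rewrite memNset// mul0r (_ : [set _ | _] `&` _ = set0) ?measure0//.
  by apply/seteqP; split=> // x [].
Qed.

Lemma zeros_identity : -1 < u -> u <= v -> v < 1 ->
  (\int[ltu N.+1]_(a in Omega R N.+1) (nb_zeros u v a)%:R%:E =
   \int[mu]_(T in `[u, v]) \int[ltu N]_(q in Omega R N) `|(monic_poly q).[T]|%:E)%E.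
Proof.
move=> u1 uv v1.
transitivity (\int[ltu N.+1]_a w a)%E.
  rewrite integral_mkcond; apply: eq_integral => a _.
  by rewrite patchE /w indicE; case: ifPn => _; rewrite ?mul1r ?mul0r.
rewrite integral_tuple_rcons//.
under eq_integral do rewrite slice//.
pose D : set mR := `]u, v]%classic.
pose dens' (p : coeffs R N * mR) : \bar R := (dens p.2 p.1 * (\1_D p.2)%:E)%E.
have mdens' : measurable_fun [set: coeffs R N * mR] dens'.
  apply: emeasurable_funM.
    exact: (measurableT_comp measurable_dens (@measurable_swap _ _ _ _)).
  apply/measurable_EFinP; apply: (measurableT_comp _ measurable_snd).
  by apply: measurable_indic; exact: measurable_itv.
have dens'0 p : (0 <= dens' p)%E by rewrite mule_ge0// lee_fin.
transitivity (\int[ltu N]_t \int[mu]_T dens' (t, T))%E.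
  apply: eq_integral => t _; rewrite integral_mkcond; apply: eq_integral => T _.
  by rewrite patchE /dens'/= indicE; case: ifPn => _; rewrite ?mule1 ?mule0.
rewrite (fubini_tonelli dens')//.
rewrite -integral_itv_obnd_cbnd; last first.
  exact: (measurable_funTS (measurable_mean_horner N)).
rewrite [RHS]integral_mkcond; apply: eq_integral => T _.
rewrite patchE; case: ifPn => [TD|TD]; last first.
  by apply: integral0_eq => t _; rewrite /dens'/= indicE (negbTE TD) mule0.
have T1 : -1 <= T <= 1.
  move: TD; rewrite inE/= in_itv/= => /andP[uT Tv].
  by rewrite (ltW (lt_trans u1 uT)) (le_trans Tv (ltW v1)).
have mT : measurable_fun [set: coeffs R N] (fun t => dens T t).
  exact: (measurableT_comp measurable_dens (pair1_measurable T)).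
transitivity (\int[ltu N]_t dens T t)%E.
  by apply: eq_integral => t _; rewrite /dens'/= indicE TD mule1.
(* After the shear the pinned polynomial is (x - T) Q, with derivative Q(T) at T; as |T| <= 1, it
   lies in [Omega] exactly when Q does. *)
rewrite -(integral_shear T 1 mT)// [RHS]integral_mkcond.
apply: eq_integral => q _; rewrite patchE /dens /pin indicE.
have [_ ->] := shear_monic_poly T q.
have -> : (tuple_rcons (shear T 1 q, - ('X * monic_poly (shear T 1 q)).[T])
    \in Omega R N.+1) = (q \in Omega R N).
  by apply/idP/idP; rewrite !inE => /(Omega_shear q T1).
by case: ifPn => _; rewrite ?mul1r ?mul0r.
Qed.

End zeros_identity.

(** * Asymptotics of the density *)

Section tannery.
Variable R : realType.

(** Dominated convergence for sums whose range grows with [m]. The domination is asked for k <= m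
    only, since the weights will involve the truncated difference m - k. *)
Lemma tannery (c : nat -> nat -> R) (l g : nat -> R) :
  (forall m k, (k <= m)%N -> `|c m k| <= g k) ->
  cvgn (series g) -> (forall k, c m k @[m --> \oo] --> l k) ->
  cvgn (series l) /\ \sum_(0 <= k < m.+1) c m k @[m --> \oo] --> limn (series l).
Proof.
move=> cg cvgg cl.
have lg k : `|l k| <= g k.
  apply: (ler_cvg_to (cvg_norm (cl k)) (cvg_cst (g k))).
  by exists k => // m /= km; exact: cg.
have g0 k : 0 <= g k by exact: le_trans (lg k).
have cvgl : cvgn (series l).
  by apply: normed_cvg; exact: (series_le_cvg _ g0 lg cvgg).
split=> //; apply/cvgrPdist_le => e e0.
have e3 : 0 < e / 3 by rewrite divr_gt0.
have gnd : nondecreasing_seq (series g) by exact: nondecreasing_series.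
have [K _ /(_ K (leqnn K)) hK] := (cvgrPdist_le _ _).1 cvgg _ e3.
have hg n : (K <= n)%N -> \sum_(K <= k < n) g k <= e / 3.
  move=> Kn; rewrite -sub_series_geq//; apply: le_trans (le_trans (ler_norm _) hK).
  by rewrite lerB// nondecreasing_cvgn_le.
have tail : `|limn (series l) - series l K| <= e / 3.
  have cK : `|series l n - series l K| @[n --> \oo] --> `|limn (series l) - series l K|.
    by apply: cvg_norm; apply: cvgB => //; exact: cvg_cst.
  apply: (ler_cvg_to cK (cvg_cst (e / 3))); exists K => // n /= Kn.
  rewrite sub_series_geq//; apply: le_trans (hg _ Kn).
  by apply: le_trans (ler_norm_sum _ _ _) _; exact: ler_sum.
have fin n : \sum_(0 <= k < n) (l k - c m k) @[m --> \oo] --> (0 : R).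
  elim: n => [|n IH].
    by under eq_fun do rewrite big_geq//; exact: cvg_cst.
  have h := cvgD IH (cvgB (cvg_cst (l n)) (cl n)).
  rewrite subrr addr0 in h; rewrite (_ : (fun m => _) =
    (fun m => \sum_(0 <= k < n) (l k - c m k)) + (cst (l n) - c^~ n)).
    exact: h.
  by apply/funext => m; rewrite big_nat_recr.
have {}fin := (cvgrPdist_le _ _).1 (fin K) _ e3.
near=> m.
have Km : (K <= m.+1)%N by near: m; exists K => // n /= Kn; exact: leqW.
rewrite (big_cat_nat (leq0n K) Km)/=.
have -> : limn (series l) - (\sum_(0 <= k < K) c m k + \sum_(K <= k < m.+1) c m k) =
   (limn (series l) - series l K) + \sum_(0 <= k < K) (l k - c m k)
     - \sum_(K <= k < m.+1) c m k by rewrite sumrB /series/=; ring.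
have -> : e = e / 3 + e / 3 + e / 3 by field.
rewrite (le_trans (ler_normB _ _))// lerD//.
  rewrite (le_trans (ler_normD _ _))// lerD//.
  by rewrite -normrN -sub0r; near: m; exact: fin.
apply: le_trans (hg _ Km); apply: le_trans (ler_norm_sum _ _ _) _.
rewrite !big_nat; apply: ler_sum => k /andP[_ km]; exact: cg.
Unshelve. all: by end_near.
Qed.

Lemma odd_geometric_sum (x : R) n :
  (1 - x) ^+ 2 * \sum_(0 <= k < n) (2 * k + 1)%:R * x ^+ k =
  1 + x - (2 * n + 1)%:R * x ^+ n + ((2 * n)%:R - 1) * x ^+ n.+1.
Proof.
elim: n => [|n IH]; first by rewrite big_geq// muln0 expr0 expr1; ring.
rewrite big_nat_recr//= mulrDr IH !exprS !natrD !natrM -natr1; ring.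
Qed.

(** In the closed form the terms of order n and n + 1 add up to at most 0, which leaves 1 + x <=
    2. *)
Lemma odd_geometric_le (x : R) n : 0 <= x < 1 ->
  \sum_(0 <= k < n) (2 * k + 1)%:R * x ^+ k <= 2 / (1 - x) ^+ 2.
Proof.
move=> /andP[x0 x1]; rewrite ler_pdivlMr ?exprn_gt0 ?subr_gt0// mulrC odd_geometric_sum.
have : (2 * n)%:R * x <= (2 * n)%:R * 1 :> R by rewrite ler_wpM2l// ltW.
have xn : 0 <= x ^+ n by rewrite exprn_ge0.
rewrite natrD exprS; nra.
Qed.

Lemma cvg_odd_geometric (x : R) : 0 <= x < 1 ->
  cvgn (series (fun k => (2 * k + 1)%:R * x ^+ k)).
Proof.
move=> x01; have /andP[x0 x1] := x01; apply: nondecreasing_is_cvgn.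
  apply: nondecreasing_series => k _ _.
  by rewrite mulr_ge0// exprn_ge0.
by exists (2 / (1 - x) ^+ 2) => _ [n _ <-]; exact: odd_geometric_le.
Qed.

Local Notation cbin := (cbin R).

(* By the symmetry [i -> n - i], [n] times the sum is the sum of
   [2i u_i u_(n-i)], and [2(i + 1) u_(i+1) = (2i + 1) u_i]. *)
Lemma cbin_convolution n : \sum_(i < n.+1) cbin i * cbin (n - i) = 1.
Proof.
elim: n => [|n IH]; first by rewrite big_ord1 !cbin0 mulr1.
have sym m : m%:R * \sum_(i < m.+1) cbin i * cbin (m - i) =
    \sum_(i < m.+1) (2 * i)%:R * (cbin i * cbin (m - i)).
  have E : \sum_(i < m.+1) i%:R * (cbin i * cbin (m - i)) =
      \sum_(i < m.+1) (m - i)%:R * (cbin i * cbin (m - i)).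
    rewrite (reindex_inj rev_ord_inj)/=; apply: eq_bigr => i _.
    by rewrite subSS subKn 1?(mulrC (cbin _))// -ltnS.
  have -> : \sum_(i < m.+1) (2 * i)%:R * (cbin i * cbin (m - i)) =
      \sum_(i < m.+1) i%:R * (cbin i * cbin (m - i)) +
      \sum_(i < m.+1) i%:R * (cbin i * cbin (m - i)).
    by rewrite -big_split/=; apply: eq_bigr => i _; rewrite natrM; ring.
  rewrite {2}E -big_split/= big_distrr/=; apply: eq_bigr => i _.
  by rewrite -mulrDl -natrD subnKC// -ltnS.
have n1 : n.+1%:R != 0 :> R by rewrite pnatr_eq0.
apply: (mulfI n1); rewrite sym big_ord_recl/= muln0 mul0r add0r.
transitivity (\sum_(i < n.+1) (2 * i + 1)%:R * (cbin i * cbin (n - i))).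
  apply: eq_bigr => i _; rewrite /bump/= add1n subSS [LHS]mulrA [RHS]mulrA; congr (_ * _).
  have -> : (2 * i.+1 = 2 * i + 2)%N by lia.
  rewrite cbinS; move: (cbin i) => c; field.
  by rewrite -natrM -natrD pnatr_eq0 addn2.
under eq_bigr do rewrite natrD mulrDl mul1r.
by rewrite big_split/= -sym IH mulr1 natr1 mulr1.
Qed.

(** The square of the truncated series has coefficients equal to 1 below degree n, by the
    convolution identity, and between 0 and 1 beyond; it therefore lies between a partial sum and
    the full sum of the geometric series. *)
Lemma cbin_sqr_bounds (x : R) n : 0 <= x < 1 ->
  (1 - x ^+ n) / (1 - x) <= (\sum_(0 <= k < n) cbin k * x ^+ k) ^+ 2 <= (1 - x)^-1.
Proof.
move=> /andP[x0 x1]; have x1' : 0 < 1 - x by rewrite subr_gt0.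
have geo m : \sum_(j < m) x ^+ j = (1 - x ^+ m) / (1 - x).
  apply: (mulIf (lt0r_neq0 x1')); rewrite divfK ?lt0r_neq0//.
  by rewrite -[RHS]opprB subrX1; ring.
pose p : {poly R} := \poly_(k < n) cbin k.
have pE : \sum_(0 <= k < n) cbin k * x ^+ k = p.[x].
  by rewrite horner_poly big_mkord.
rewrite pE expr2 -hornerM.
have sp : (size (p * p)%R <= 2 * n)%N.
  apply: leq_trans (size_polyMleq _ _) _.
  have := size_poly n cbin; rewrite -/p; lia.
have coefp2 j : (p * p)`_j <= 1.
  rewrite coefM -(cbin_convolution j); apply: ler_sum => i _.
  rewrite !coef_poly; do 2 case: ifP => _; rewrite ?mulr0 ?mul0r ?lexx//;
  by rewrite mulr_ge0// ltW// cbin_gt0.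
have coefp2_ge0 j : 0 <= (p * p)`_j.
  rewrite coefM; apply: sumr_ge0 => i _; rewrite !coef_poly.
  by do 2 case: ifP => _; rewrite ?mulr0 ?mul0r ?lexx// mulr_ge0// ltW// cbin_gt0.
have coefp2_eq1 j : (j < n)%N -> (p * p)`_j = 1.
  move=> jn; rewrite coefM -(cbin_convolution j); apply: eq_bigr => i _.
  by rewrite !coef_poly (leq_ltn_trans _ jn) ?(leq_ltn_trans (leq_subr _ _) jn)// -ltnS.
rewrite (horner_coef_wide _ sp); apply/andP; split.
  rewrite -geo mul2n -addnn big_split_ord/= -[leLHS]addr0 lerD//.
    by apply: ler_sum => i _; rewrite coefp2_eq1// mul1r.
  by apply: sumr_ge0 => i _; rewrite mulr_ge0// exprn_ge0.
apply: (@le_trans _ _ (\sum_(j < 2 * n) x ^+ j)).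
  by apply: ler_sum => i _; rewrite -[leRHS]mul1r ler_wpM2r// exprn_ge0.
rewrite geo ler_pdivrMr// mulVf ?lt0r_neq0// gerBl exprn_ge0//.
Qed.

(** The limit density contains this sum twice, so its square is all that has to be identified. *)
Lemma cbin_gen_sqr (x : R) : 0 <= x < 1 ->
  cvgn (series (fun k => cbin k * x ^+ k)) ->
  limn (series (fun k => cbin k * x ^+ k)) ^+ 2 = (1 - x)^-1.
Proof.
move=> x01 cS; have /andP[x0 x1] := x01.
have c2 : (series (fun k => cbin k * x ^+ k) n) ^+ 2 @[n --> \oo] -->
    limn (series (fun k => cbin k * x ^+ k)) ^+ 2.
  by rewrite expr2; under eq_fun do rewrite expr2; exact: cvgM.
have c1 : (series (fun k => cbin k * x ^+ k) n) ^+ 2 @[n --> \oo] --> (1 - x)^-1.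
  have xn : x ^+ n @[n --> \oo] --> (0 : R) by apply: cvg_expr; rewrite ger0_norm.
  have lo : (1 - x ^+ n) / (1 - x) @[n --> \oo] --> (1 - 0) * (1 - x)^-1.
    by apply: cvgM; [apply: cvgB => //|]; exact: cvg_cst.
  rewrite subr0 mul1r in lo.
  apply: (squeeze_cvgr _ lo (cvg_cst _)).
  by apply: nearW => n; exact: cbin_sqr_bounds.
exact: (cvg_unique _ c2 c1).
Qed.

End tannery.

(** * Wallis integrals and central binomial coefficients *)

Section wallis.
Variable R : realType.
Local Notation mu := (@lebesgue_measure R).
Local Notation cbin := (cbin R).

Definition wallis (n : nat) : R := \int[mu]_(x in `[0, pi]) sin x ^+ n.

Lemma continuous_sinX n : continuous (fun x : R => sin x ^+ n).
Proof.
move=> x; apply: (@continuous_comp _ _ _ (@sin R) (fun y => y ^+ n)).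
  exact: continuous_sin.
exact: exprn_continuous.
Qed.

Lemma integrable_continuous_itv (f : R -> R) (u v : R) : continuous f ->
  mu.-integrable `[u, v] (EFin \o f).
Proof.
move=> cf; apply: continuous_compact_integrable; first exact: segment_compact.
exact: continuous_subspaceT.
Qed.

Lemma integrable_sinX n : mu.-integrable `[0, pi] (EFin \o (fun x : R => sin x ^+ n)).
Proof. exact/integrable_continuous_itv/continuous_sinX. Qed.

Lemma wallis0 : wallis 0 = pi.
Proof.
rewrite /wallis; under eq_Rintegral do rewrite expr0.
rewrite Rintegral_cst//= lebesgue_measure_itv/= lte_fin pi_gt0.
by rewrite mul1r /= subr0.
Qed.

Lemma wallis1 : wallis 1 = 2.
Proof.
rewrite /wallis /Rintegral (@continuous_FTC2 _ _ (fun x : R => - cos x)) ?pi_gt0//.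
- by rewrite cospi cos0 /=; lra.
- exact/continuous_subspaceT/continuous_sinX.
- split.
  + by move=> x _; apply: derivableN.
  + by apply: cvg_at_right_filter; apply: cvgN; exact: continuous_cos.
  + by apply: cvg_at_left_filter; apply: cvgN; exact: continuous_cos.
- move=> x _; rewrite derive1E deriveN// derive_val opprK expr1; by [].
Qed.

(** The function - cos x sin^(n+1) x vanishes at 0 and pi, and its derivative is (n + 2) sin^(n+2) x
    - (n + 1) sin^n x. *)
Lemma wallisSS n : n.+2%:R * wallis n.+2 = n.+1%:R * wallis n.
Proof.
have d (x : R) : is_derive x 1 (fun x : R => - (cos x * sin x ^+ n.+1))
    (n.+2%:R * sin x ^+ n.+2 - n.+1%:R * sin x ^+ n).
  have h := is_deriveN (is_deriveM (is_derive_cos x) (is_deriveX n.+1 (is_derive_sin x))).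
  rewrite (_ : (fun _ => _) = - (cos * sin ^+ n.+1)); last first.
    by apply/funext => y; rewrite !fctE.
  apply: (trigger_derive h); rewrite exprfctE /GRing.scale/=.
  have c2 := cos2sin2 x; rewrite !exprS -!natr1.
  move: (sin x ^+ n) c2 => s c2.
  have -> : - (cos x * ((n%:R + 1) * s * cos x) + sin x * s * - sin x) =
     - (n%:R + 1) * s * cos x ^+ 2 + s * sin x ^+ 2 by ring.
  by rewrite c2; ring.
have : \int[mu]_(x in `[0, pi]) (n.+2%:R * sin x ^+ n.+2 - n.+1%:R * sin x ^+ n) = 0 :> R.
  rewrite /Rintegral (@continuous_FTC2 _ _ (fun x : R => - (cos x * sin x ^+ n.+1))) ?pi_gt0//.
  + by rewrite sinpi sin0 !expr0n/= !mulr0 subrr.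
  + apply/continuous_subspaceT => x.
    by apply: cvgB; apply: cvgM; do ?[exact: cvg_cst|exact: continuous_sinX].
  + have c x : {for x, continuous (fun x : R => - (cos x * sin x ^+ n.+1))}.
      by apply: cvgN; apply: cvgM; [exact: continuous_cos|exact: continuous_sinX].
    split=> [x _||]; first by apply: ex_derive.
      by apply: cvg_at_right_filter; exact: c.
    by apply: cvg_at_left_filter; exact: c.
  + by move=> x _; rewrite derive1E derive_val.
rewrite RintegralB//=; last 2 first.
- apply: integrable_continuous_itv => x.
  by apply: cvgM; [exact: cvg_cst|exact: continuous_sinX].
- apply: integrable_continuous_itv => x.
  by apply: cvgM; [exact: cvg_cst|exact: continuous_sinX].
rewrite !RintegralZl//; [|exact: integrable_sinX|exact: integrable_sinX].
by move/eqP; rewrite subr_eq0 => /eqP.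
Qed.

Lemma wallis_le n : wallis n.+1 <= wallis n.
Proof.
apply: le_Rintegral => //; [exact: integrable_sinX|exact: integrable_sinX|].
move=> x /=; rewrite in_itv/= => x0pi.
by rewrite exprS ler_piMl ?exprn_ge0 ?sin_ge0_pi// sin_le1.
Qed.

Lemma wallis_even n : wallis (2 * n) = pi * cbin n.
Proof.
elim: n => [|n IH]; first by rewrite muln0 wallis0 cbin0 mulr1.
have h : (2 * n).+2%:R != 0 :> R by rewrite pnatr_eq0.
apply: (mulfI h); have -> : (2 * n.+1 = (2 * n).+2)%N by lia.
rewrite wallisSS IH cbinS; move: (cbin n) => c.
by rewrite -addn1 -addn2; field; rewrite -natrM -natrD pnatr_eq0 addn2.
Qed.

Lemma wallis_odd n : wallis (2 * n + 1) = 2 / ((2 * n + 1)%:R * cbin n).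
Proof.
elim: n => [|n IH]; first by rewrite muln0 add0n wallis1 cbin0 mulr1 divr1.
have h : (2 * n + 1).+2%:R != 0 :> R by rewrite pnatr_eq0.
apply: (mulfI h); have -> : (2 * n.+1 + 1 = (2 * n + 1).+2)%N by lia.
rewrite wallisSS IH cbinS.
have := cbin_gt0 R n; move: (cbin n) => c c0.
have n1 : (2 * n + 1)%:R != 0 :> R by rewrite pnatr_eq0 addn1.
have n2 : (2 * n + 2)%:R != 0 :> R by rewrite pnatr_eq0 addn2.
have -> : ((2 * n + 1).+1 = 2 * n + 2)%N by lia.
move: h n1 n2; move: (_.+2)%:R (_ + 1)%:R (_ + 2)%:R => x y z x0 y0 z0.
by field; rewrite z0 y0 (gt_eqF c0) -natrM -natrD nat1r pnatr_eq0.
Qed.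

Lemma cvg_inv_odd : (2 * n + 1)%:R^-1 @[n --> \oo] --> (0 : R).
Proof.
apply: (squeeze_cvgr _ (cvg_cst _) (@cvg_harmonic R)); apply: nearW => n.
rewrite invr_ge0 ler0n/= /harmonic/= lef_pV2 ?posrE ?ltr0n ?addn1//.
by rewrite ler_nat ltnS leq_pmull.
Qed.

(** Monotonicity of the Wallis integrals from 2n to 2n + 1 gives the lower bound 2 / pi, and from 2n
    + 1 to 2n + 2 the upper bound with the extra factor (2n + 2) / (2n + 1). *)
Lemma cbin_sqr_cvg : (2 * n + 1)%:R * cbin n ^+ 2 @[n --> \oo] --> 2 / (pi : R).
Proof.
have p0 := pi_gt0 R.
have lo n : 2 / pi <= (2 * n + 1)%:R * cbin n ^+ 2.
  have := wallis_le (2 * n); rewrite -addn1 wallis_even wallis_odd.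
  have c0 := cbin_gt0 R n; have n0 : 0 < (2 * n + 1)%:R :> R by rewrite ltr0n addn1.
  move: (cbin n) (2 * n + 1)%:R c0 n0 => c x c0 n0.
  rewrite ler_pdivrMr ?mulr_gt0// => h; rewrite ler_pdivrMr//; nra.
have hi n : (2 * n + 1)%:R * cbin n ^+ 2 <= 2 / pi * (1 + (2 * n + 1)%:R^-1).
  have := wallis_le (2 * n + 1); rewrite wallis_odd.
  have -> : ((2 * n + 1).+1 = 2 * n.+1)%N by lia.
  rewrite wallis_even cbinS.
  have c0 := cbin_gt0 R n; have n0 : 0 < (2 * n + 1)%:R :> R by rewrite ltr0n addn1.
  have n2 : 0 < (2 * n + 2)%:R :> R by rewrite ltr0n addn2.
  have -> : (2 * n + 2)%:R = (2 * n + 1)%:R + 1 :> R by rewrite natr1 addn1 addn2.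
  move: (cbin n) (2 * n + 1)%:R c0 n0 => c x c0 n0.
  move: (pi : R) p0 => p p0; rewrite ler_pdivlMr ?mulr_gt0// => h.
  have x1 : 0 < x + 1 by rewrite addr_gt0.
  have -> : 2 / p * (1 + x^-1) = 2 * ((x + 1) / (p * x)).
    by field; rewrite (gt_eqF n0) (gt_eqF p0).
  rewrite -ler_pdivrMr ?divr_gt0 ?mulr_gt0//; apply: le_trans h.
  rewrite le_eqVlt; apply/orP; left; apply/eqP; field.
  by rewrite (gt_eqF n0) (gt_eqF p0) (gt_eqF x1).
have lim : 2 / pi * (1 + (2 * n + 1)%:R^-1) @[n --> \oo] --> 2 / pi * (1 + 0 : R).
  apply: cvgM; first exact: cvg_cst.
  apply: cvgD; first exact: cvg_cst.
  exact: cvg_inv_odd.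
rewrite addr0 mulr1 in lim.
apply: (squeeze_cvgr _ (cvg_cst _) lim).
by apply: nearW => n; rewrite lo hi.
Qed.

End wallis.

(** * The density of zeros and its limit *)

Section density.
Variable R : realType.
Local Notation cbin := (cbin R).

(** The coefficient of x^n in (1 - x)^(-3/2). *)
Definition odd_cbin (n : nat) : R := (2 * n + 1)%:R * cbin n.

Lemma odd_cbin_gt0 n : 0 < odd_cbin n.
Proof. by rewrite mulr_gt0 ?cbin_gt0// ltr0n addn1. Qed.

Lemma cbin_ratio n : cbin n / cbin n.+1 = 1 + (2 * n + 1)%:R^-1.
Proof.
rewrite cbinS; have := cbin_gt0 R n; move: (cbin n) => c c0.
have n1 : (2 * n + 1)%:R != 0 :> R by rewrite pnatr_eq0 addn1.
have n2 : (2 * n + 2)%:R != 0 :> R by rewrite pnatr_eq0 addn2.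
have E : (2 * n + 2)%:R = (2 * n + 1)%:R + 1 :> R by rewrite natr1 addn1 addn2.
rewrite E in n2 *; move: (2 * n + 1)%:R n1 n2 => x x0 x1.
by field; rewrite x0 x1 (gt_eqF c0).
Qed.

Lemma odd_cbin_ratio n : odd_cbin n / odd_cbin n.+1 = 1 - (2 * n.+1 + 1)%:R^-1.
Proof.
rewrite /odd_cbin cbinS; have := cbin_gt0 R n; move: (cbin n) => c c0.
have n1 : (2 * n + 1)%:R != 0 :> R by rewrite pnatr_eq0 addn1.
have n2 : (2 * n + 2)%:R != 0 :> R by rewrite pnatr_eq0 addn2.
have n3 : (2 * n.+1 + 1)%:R != 0 :> R by rewrite pnatr_eq0 addn1.
have E : (2 * n.+1 + 1)%:R = (2 * n + 2)%:R + 1 :> R by rewrite natr1; congr (_%:R); lia.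
rewrite E in n3 *; move: (2 * n + 1)%:R (2 * n + 2)%:R n1 n2 n3 => x y x0 y0 y1.
by field; rewrite x0 y0 y1 (gt_eqF c0).
Qed.

Lemma cbin_nincr n : cbin n.+1 <= cbin n.
Proof.
rewrite -[leRHS](@divfK _ (cbin n.+1)) ?gt_eqF ?cbin_gt0// cbin_ratio.
by rewrite ler_peMl ?(ltW (cbin_gt0 _ _))// lerDl invr_ge0.
Qed.

Lemma cbin_le1 n : cbin n <= 1.
Proof.
elim: n => [|n IH]; first by rewrite cbin0.
exact: le_trans (cbin_nincr n) IH.
Qed.

Lemma odd_cbin_ndecr : nondecreasing_seq odd_cbin.
Proof.
apply/nondecreasing_seqP => n.
rewrite -[leLHS](@divfK _ (odd_cbin n.+1)) ?gt_eqF ?odd_cbin_gt0// odd_cbin_ratio.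
by rewrite ler_piMl ?(ltW (odd_cbin_gt0 _))// gerBl invr_ge0.
Qed.

Lemma odd_cbin_ratio_le m k : (k <= m)%N ->
  `|odd_cbin (m - k) / odd_cbin m| <= (2 * k + 1)%:R.
Proof.
move=> km; rewrite ger0_norm ?divr_ge0 ?(ltW (odd_cbin_gt0 _))//.
rewrite ler_pdivrMr ?odd_cbin_gt0//.
apply: le_trans (odd_cbin_ndecr (leq_subr k m)) _.
by rewrite ler_peMl ?(ltW (odd_cbin_gt0 _))// ler1n addn1.
Qed.

(** [cbin] decreases, so this ratio is at least 1; that [odd_cbin] increases bounds it by (2m + 1) /
    (2 (m - k) + 1), which is at most 2k + 1. *)
Lemma cbin_ratio_le m k : (k <= m)%N -> `|cbin (m - k) / cbin m| <= (2 * k + 1)%:R.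
Proof.
move=> km; rewrite ger0_norm ?divr_ge0 ?(ltW (cbin_gt0 _ _))//.
rewrite ler_pdivrMr ?cbin_gt0//.
have h := odd_cbin_ndecr (leq_subr k m); rewrite /odd_cbin in h.
have d0 : 0 < (2 * (m - k) + 1)%:R :> R by rewrite ltr0n addn1.
rewrite -(ler_pM2l d0); apply: le_trans h _.
rewrite [leRHS]mulrA ler_wpM2r ?(ltW (cbin_gt0 _ _))// -natrM ler_nat; nia.
Qed.

(** The sequence (2n + 1) u_n^2 starts at 1 and decreases. *)
Lemma odd_cbin_cbin_le1 n : odd_cbin n * cbin n <= 1.
Proof.
elim: n => [|n]; first by rewrite /odd_cbin cbin0 muln0 add0n !mulr1.
apply: le_trans; rewrite /odd_cbin cbinS.
have := cbin_gt0 R n; move: (cbin n) => c c0.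
have x0 : 0 <= n%:R :> R by [].
have -> : (2 * n.+1 + 1)%:R = 2 * n%:R + 3 :> R by rewrite !natrD natrM -natr1; ring.
have -> : (2 * n + 1)%:R = 2 * n%:R + 1 :> R by rewrite natrD natrM.
have -> : (2 * n + 2)%:R = 2 * n%:R + 2 :> R by rewrite natrD natrM.
move: n%:R x0 => x x0.
have y0 : 0 < 2 * x + 2 by lra.
rewrite -subr_ge0.
have -> : (2 * x + 1) * c * c - (2 * x + 3) * (c * (2 * x + 1) / (2 * x + 2))
    * (c * (2 * x + 1) / (2 * x + 2)) = (2 * x + 1) * c ^+ 2 / (2 * x + 2) ^+ 2.
  by field; rewrite gt_eqF.
by rewrite divr_ge0 ?exprn_ge0 ?(ltW y0)// mulr_ge0 ?exprn_ge0 ?(ltW c0)//; lra.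
Qed.

Section weighted_sum.
Variable s : nat -> R.
Hypothesis s_gt0 : forall n, 0 < s n.
Hypothesis s_le : forall m k, (k <= m)%N -> `|s (m - k)%N / s m| <= (2 * k + 1)%:R.
Hypothesis s_cvg : s n / s n.+1 @[n --> \oo] --> (1 : R).

Lemma cvg_ratio_shift k : s (m - k)%N / s m @[m --> \oo] --> (1 : R).
Proof.
suff h : s n / s (n + k)%N @[n --> \oo] --> (1 : R).
  rewrite -(cvg_shiftn k); apply: cvg_trans h; apply: near_eq_cvg.
  by apply: nearW => n /=; rewrite addnK.
elim: k => [|k IH].
  rewrite (_ : (fun n => _) = cst 1); first exact: cvg_cst.
  by apply/funext => n; rewrite addn0 divff// gt_eqF.
have h : s (n + k)%N / s (n + k).+1 @[n --> \oo] --> (1 : R).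
  have := s_cvg; rewrite -(cvg_shiftn k (fun n => s n / s n.+1)).
  by apply: cvg_trans; apply: near_eq_cvg; exact: nearW.
have h2 : s n / s (n + k)%N * (s (n + k)%N / s (n + k).+1) @[n --> \oo] --> (1 * 1 : R).
  exact: cvgM.
rewrite mulr1 in h2; apply: cvg_trans h2; apply: near_eq_cvg; apply: nearW => n.
by rewrite addnS mulrA divfK// gt_eqF.
Qed.

(** Both conjectural sums have this form, with [odd_cbin] or [cbin] for [s]. Division by [s m] makes
    every weight tend to 1. *)
Definition weighted_sum m (x : R) : R :=
  \sum_(0 <= k < m.+1) s (m - k)%N / s m * (cbin k * x ^+ k).

Lemma weighted_sum_bound (x : R) m k : 0 <= x -> (k <= m)%N ->
  `|s (m - k)%N / s m * (cbin k * x ^+ k)| <= (2 * k + 1)%:R * x ^+ k.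
Proof.
move=> x0 km; have c0 := cbin_gt0 R k; rewrite normrM ler_pM// ?s_le//.
rewrite ger0_norm ?mulr_ge0 ?exprn_ge0 ?(ltW c0)//.
by rewrite ler_piMl ?exprn_ge0// cbin_le1.
Qed.

Lemma weighted_sum_le (x : R) m : 0 <= x < 1 -> `|weighted_sum m x| <= 2 / (1 - x) ^+ 2.
Proof.
move=> x01; have /andP[x0 x1] := x01.
apply: le_trans (odd_geometric_le m.+1 x01); apply: le_trans (ler_norm_sum _ _ _) _.
by rewrite !big_nat; apply: ler_sum => k /andP[_ km]; exact: weighted_sum_bound.
Qed.

Lemma weighted_sum_cvg (x : R) : 0 <= x < 1 ->
  weighted_sum m x @[m --> \oo] --> limn (series (fun k => cbin k * x ^+ k)).
Proof.
move=> x01; have /andP[x0 x1] := x01.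
have [] // := @tannery R (fun m k => s (m - k)%N / s m * (cbin k * x ^+ k))
  (fun k => cbin k * x ^+ k) (fun k => (2 * k + 1)%:R * x ^+ k).
- by move=> m k; exact: weighted_sum_bound.
- exact: cvg_odd_geometric.
- move=> k; rewrite -[X in _ --> X]mul1r; apply: cvgM; first exact: cvg_ratio_shift.
  exact: cvg_cst.
Qed.

End weighted_sum.

Lemma cvg_half : n./2 @[n --> \oo] --> \oo.
Proof.
apply/cvgnyPge => A; exists (2 * A)%N => // n /= An.
by rewrite -(doubleK A) half_leq// -mul2n.
Qed.

Lemma cvg_uphalf : uphalf n @[n --> \oo] --> \oo.
Proof.
apply/cvgnyPge => A; exists (2 * A)%N => // n /= An.
by rewrite uphalf_half (leq_trans _ (leq_addl _ _))// -(doubleK A) half_leq// -mul2n.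
Qed.

(** For odd n the two indices are m and m + 1, and u_(m+1) / u_m = (2m + 1) / (2m + 2) lies between
    1 - 1 / (2m + 1) and 1, so one squeeze serves both parities. *)
Lemma cvg_odd_cbin_cbin : odd_cbin n./2 * cbin (uphalf n) @[n --> \oo] --> (2 / pi : R).
Proof.
pose w n := (2 * n + 1)%:R * cbin n ^+ 2.
have cw : w n./2 @[n --> \oo] --> (2 / pi : R).
  exact: (cvg_comp _ _ cvg_half (@cbin_sqr_cvg R)).
have co : (2 * n./2 + 1)%:R^-1 @[n --> \oo] --> (0 : R).
  exact: (cvg_comp _ _ cvg_half (@cvg_inv_odd R)).
have lo : w n./2 * (1 - (2 * n./2 + 1)%:R^-1) @[n --> \oo] --> (2 / pi * (1 - 0) : R).
  by apply: cvgM => //; apply: cvgB => //; exact: cvg_cst.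
rewrite subr0 mulr1 in lo; apply: (squeeze_cvgr _ lo cw).
apply: nearW => n; rewrite uphalf_half; move: n./2 => m.
have -> : w m = odd_cbin m * cbin m by rewrite /w expr2 [LHS]mulrA.
have := odd_cbin_gt0 m; move: (odd_cbin m) => o o0; have c0 := cbin_gt0 R m.
case: (odd n); rewrite ?add0n ?add1n -mulrA !(ler_pM2l o0).
  rewrite cbin_nincr andbT cbinS -mulrA ler_pM2l//.
  have x0 : 0 < (2 * m + 1)%:R :> R by rewrite ltr0n addn1.
  have -> : (2 * m + 2)%:R = (2 * m + 1)%:R + 1 :> R by rewrite natr1 addn1 addn2.
  rewrite ler_pdivlMr; last by rewrite addr_gt0.
  have -> : (1 - (2 * m + 1)%:R^-1) * ((2 * m + 1)%:R + 1) =
     (2 * m + 1)%:R - (2 * m + 1)%:R^-1 :> R by field; rewrite gt_eqF.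
  by rewrite gerBl invr_ge0 ltW.
move: (cbin m) c0 => c c0.
by rewrite lexx andbT ger_pMr// gerBl invr_ge0.
Qed.

(** The density of zeros in degree n + 1, not n: the conjectural mean in degree n times D_n /
    D_(n+1). *)
Definition density n (T : R) : R :=
  2^-1 * (odd_cbin n./2 * cbin (uphalf n)) *
  (weighted_sum odd_cbin n./2 (T ^+ 2) * weighted_sum cbin (uphalf n) (T ^+ 2)).

Lemma cvg_density (T : R) : -1 < T < 1 ->
  density n T @[n --> \oo] --> (pi * (1 - T ^+ 2))^-1.
Proof.
move=> T1; have x01 : 0 <= T ^+ 2 < 1.
  by have /andP[? ?] := T1; rewrite sqr_ge0/=; nra.
have ro : odd_cbin n / odd_cbin n.+1 @[n --> \oo] --> (1 : R).
  have h : 1 - (2 * n.+1 + 1)%:R^-1 @[n --> \oo] --> (1 - 0 : R).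
    apply: cvgB; first exact: cvg_cst.
    have := @cvg_inv_odd R; rewrite -cvg_shiftS.
    by apply: cvg_trans; apply: near_eq_cvg; exact: nearW.
  rewrite subr0 in h; apply: cvg_trans h; apply: near_eq_cvg.
  by apply: nearW => n; rewrite odd_cbin_ratio.
have rc : cbin n / cbin n.+1 @[n --> \oo] --> (1 : R).
  have h : 1 + (2 * n + 1)%:R^-1 @[n --> \oo] --> (1 + 0 : R).
    by apply: cvgD; [exact: cvg_cst|exact: cvg_inv_odd].
  rewrite addr0 in h; apply: cvg_trans h; apply: near_eq_cvg.
  by apply: nearW => n; rewrite cbin_ratio.
have cA := weighted_sum_cvg odd_cbin_gt0 odd_cbin_ratio_le ro x01.
have cB := weighted_sum_cvg (@cbin_gt0 R) cbin_ratio_le rc x01.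
set S := limn _ in cA cB.
have tk k : 0 <= (T ^+ 2) ^+ k by rewrite exprn_ge0// sqr_ge0.
have S2 : S ^+ 2 = (1 - T ^+ 2)^-1.
  apply: cbin_gen_sqr => //; apply: (series_le_cvg _ _ _ (cvg_odd_geometric x01)).
  - by move=> k; exact: mulr_ge0 (ltW (cbin_gt0 R k)) (tk k).
  - by move=> k; exact: mulr_ge0 (tk k).
  - move=> k; rewrite ler_wpM2r//.
    by rewrite (le_trans (cbin_le1 k))// ler1n addn1.
have -> : (pi * (1 - T ^+ 2))^-1 = 2^-1 * (2 / pi) * (S * S).
  by rewrite -expr2 S2 invfM mulrA mulVf// mul1r.
apply: cvgM; first by apply: cvgM; [exact: cvg_cst|exact: cvg_odd_cbin_cbin].
apply: cvgM; first exact: (cvg_comp _ _ cvg_half cA).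
exact: (cvg_comp _ _ cvg_uphalf cB).
Qed.

(** The constant is not sharp; what matters is that it depends neither on [n] nor on [T], so that it
    can dominate. *)
Lemma density_bound n (T r : R) : 0 <= r < 1 -> `|T| <= r ->
  `|density n T| <= 2 * (2 / (1 - r ^+ 2) ^+ 2) ^+ 2.
Proof.
move=> /andP[r0 r1] Tr.
have xr : T ^+ 2 <= r ^+ 2.
  by rewrite -(real_normK (num_real T)) lerXn2r ?nnegrE.
have r21 : r ^+ 2 < 1 by rewrite expr_lt1.
have x01 : 0 <= T ^+ 2 < 1 by rewrite sqr_ge0 (le_lt_trans xr).
pose G := 2 / (1 - r ^+ 2) ^+ 2.
have TG : 2 / (1 - T ^+ 2) ^+ 2 <= G.
  rewrite ler_wpM2l// lef_pV2 ?posrE ?exprn_gt0 ?subr_gt0//; last by case/andP: x01.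
  by rewrite lerXn2r ?nnegrE ?subr_ge0 ?(ltW r21)// ?lerB//; case/andP: x01 => _ /ltW.
have A := le_trans (weighted_sum_le odd_cbin_ratio_le n./2 x01) TG.
have B := le_trans (weighted_sum_le cbin_ratio_le (uphalf n) x01) TG.
rewrite normrM; have -> : 2 * G ^+ 2 = 2 * (G * G) by rewrite expr2.
apply: ler_pM => //; last by rewrite normrM ler_pM.
have c0 := cbin_gt0 R; have h : 0 <= odd_cbin n./2 * cbin (uphalf n).
  exact: mulr_ge0 (ltW (odd_cbin_gt0 _)) (ltW (c0 _)).
rewrite ger0_norm ?mulr_ge0//.
have : odd_cbin n./2 * cbin (uphalf n) <= 1.
  apply: le_trans (odd_cbin_cbin_le1 n./2); rewrite ler_pM2l ?odd_cbin_gt0//.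
  by rewrite uphalf_half; case: (odd n); rewrite ?add0n ?add1n ?cbin_nincr.
by move: (odd_cbin _ * _) h => y y0 y1; lra.
Qed.

End density.

(** * The expected number of zeros *)

Section expectation.
Variable R : realType.
Local Notation mu := (@lebesgue_measure R).
Local Notation ltu := (lebesgue_tuple R).
Local Notation mR := (measurableTypeR R).
Local Notation cbin := (cbin R).

(** Makes the normalization in [Omega_mean] a genuine division by a positive real. *)
Lemma Omega_volume_fin N : exists2 v : R, 0 < v & Omega_volume R N = v%:E.
Proof.
elim: N => [|N [v v0 vE]].
  exists 1 => //; rewrite /Omega_volume /= diracE mem_set// => z.
  by rewrite /monic_poly big_ord0 addr0 expr0 rmorph1 (negbTE (root1 _)).
exists (2 / ((2 * N./2 + 1)%:R * cbin N./2) * v); last by rewrite Omega_volumeS vE EFinM.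
by rewrite mulr_gt0// divr_gt0// (odd_cbin_gt0 R N./2).
Qed.

Lemma weighted_sumE (s : nat -> R) m x : s m != 0 ->
  s m * weighted_sum s m x = \sum_(0 <= k < m.+1) s (m - k)%N * (cbin k * x ^+ k).
Proof.
move=> sm; rewrite /weighted_sum big_distrr/=; apply: eq_bigr => k _.
by move: (cbin k) => c; field.
Qed.

Lemma binE n : 'C(2 * n, n)%:R = 4 ^+ n * cbin n.
Proof. by rewrite /cbin mulrC divfK// expf_neq0// pnatr_eq0. Qed.

Lemma sum_odd_binE m T :
  \sum_(0 <= k < m.+1) (2 * m - 2 * k + 1)%:R / (2 * m + 1)%:R
    * 'C(2 * m - 2 * k, m - k)%:R * 'C(2 * k, k)%:R * T ^+ (2 * k) =
  4 ^+ m / (2 * m + 1)%:R * (odd_cbin R m * weighted_sum (odd_cbin R) m (T ^+ 2)).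
Proof.
rewrite weighted_sumE ?gt_eqF ?odd_cbin_gt0// big_distrr/= !big_nat.
apply: eq_bigr => k /andP[_]; rewrite ltnS => km.
have -> : 4 ^+ m = 4 ^+ (m - k) * 4 ^+ k :> R by rewrite -exprD subnK.
rewrite -mulnBr !binE /odd_cbin exprM.
have : (2 * m + 1)%:R != 0 :> R by rewrite pnatr_eq0 addn1.
move: (cbin k) (cbin (m - k)) (2 * (m - k) + 1)%:R (2 * m + 1)%:R => c d y z z0.
by field.
Qed.

Lemma sum_binE m T :
  \sum_(0 <= k < m.+1) 'C(2 * m - 2 * k, m - k)%:R * 'C(2 * k, k)%:R * T ^+ (2 * k) =
  4 ^+ m * (cbin m * weighted_sum cbin m (T ^+ 2)).
Proof.
rewrite weighted_sumE ?gt_eqF ?cbin_gt0// big_distrr/= !big_nat.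
apply: eq_bigr => k /andP[_]; rewrite ltnS => km.
have -> : 4 ^+ m = 4 ^+ (m - k) * 4 ^+ k :> R by rewrite -exprD subnK.
rewrite -mulnBr !binE exprM.
by move: (cbin k) (cbin (m - k)) => c d; ring.
Qed.

Definition mean_even_formula m (T : R) : R :=
  1 / (2 ^+ (2 * m) * 'C(2 * m, m)%:R)
  * (\sum_(0 <= k < m.+1) (2 * m - 2 * k + 1)%:R / (2 * m + 1)%:R
       * 'C(2 * m - 2 * k, m - k)%:R * 'C(2 * k, k)%:R * T ^+ (2 * k))
  * (\sum_(0 <= k < m.+1) 'C(2 * m - 2 * k, m - k)%:R * 'C(2 * k, k)%:R * T ^+ (2 * k)).

Definition mean_odd_formula m (T : R) : R :=
  1 / (2 ^+ (2 * m + 2) * 'C(2 * m, m)%:R)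
  * (\sum_(0 <= k < m.+1) (2 * m - 2 * k + 1)%:R / (2 * m + 1)%:R
       * 'C(2 * m - 2 * k, m - k)%:R * 'C(2 * k, k)%:R * T ^+ (2 * k))
  * (\sum_(0 <= k < m.+2) 'C(2 * m + 2 - 2 * k, m + 1 - k)%:R * 'C(2 * k, k)%:R
       * T ^+ (2 * k)).

(** The factor [2 / odd_cbin R m] is the volume ratio of [Omega_volumeS], and will cancel against
    it. *)
Lemma density_even m T :
  mean_even_formula m T = 2 / odd_cbin R m * density (2 * m) T.
Proof.
rewrite /mean_even_formula sum_odd_binE sum_binE /density.
have -> : (2 * m)./2 = m by rewrite mul2n doubleK.
have -> : uphalf (2 * m) = m by rewrite mul2n uphalf_double.
rewrite exprM binE (_ : 2 ^+ 2 = 4 :> R); last by rewrite -natrX.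
have f0 : 4 ^+ m != 0 :> R by rewrite expf_neq0// pnatr_eq0.
have x0 : (2 * m + 1)%:R != 0 :> R by rewrite pnatr_eq0 addn1.
rewrite {2}/odd_cbin.
move: (weighted_sum _ _ _) (weighted_sum _ _ _) => A B.
rewrite /odd_cbin.
have c0 := cbin_gt0 R m; move: (cbin m) (2 * m + 1)%:R (4 ^+ m) c0 x0 f0 => c x f c0 x0 f0.
by field; rewrite f0 x0 (gt_eqF c0).
Qed.

Lemma density_odd m T :
  mean_odd_formula m T = 2 / odd_cbin R m * density (2 * m + 1) T.
Proof.
have -> : mean_odd_formula m T = 1 / (2 ^+ (2 * m.+1) * 'C(2 * m, m)%:R)
  * (\sum_(0 <= k < m.+1) (2 * m - 2 * k + 1)%:R / (2 * m + 1)%:R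
       * 'C(2 * m - 2 * k, m - k)%:R * 'C(2 * k, k)%:R * T ^+ (2 * k))
  * (\sum_(0 <= k < m.+2) 'C(2 * m.+1 - 2 * k, m.+1 - k)%:R * 'C(2 * k, k)%:R
       * T ^+ (2 * k)).
  have e2 : (2 * m + 2 = 2 * m.+1)%N by lia.
  by rewrite /mean_odd_formula e2 (addn1 m).
rewrite sum_odd_binE sum_binE /density.
have -> : (2 * m + 1)./2 = m by lia.
have -> : uphalf (2 * m + 1) = m.+1 by lia.
rewrite exprM binE (_ : 2 ^+ 2 = 4 :> R); last by rewrite -natrX.
have f0 : 4 ^+ m != 0 :> R by rewrite expf_neq0// pnatr_eq0.
have x0 : (2 * m + 1)%:R != 0 :> R by rewrite pnatr_eq0 addn1.
rewrite exprS.
move: (weighted_sum _ _ _) (weighted_sum _ _ _) => A B.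
rewrite /odd_cbin; move: (cbin m.+1) => d.
have c0 := cbin_gt0 R m; move: (cbin m) (2 * m + 1)%:R (4 ^+ m) c0 x0 f0 => c x f c0 x0 f0.
by field; rewrite f0 x0 (gt_eqF c0).
Qed.

Lemma continuous_inv_one_minus_sqr (T : R) : -1 < T < 1 ->
  {for T, continuous (fun T : R => 1 / (1 - T ^+ 2))}.
Proof.
move=> /andP[T1 T2]; apply: cvgM; first exact: cvg_cst.
apply: cvgV; first by rewrite gt_eqF//; nra.
by apply: cvgB; [exact: cvg_cst|exact: exprn_continuous].
Qed.

Lemma within_continuous_inv_one_minus_sqr (a b : R) : -1 < a -> b < 1 ->
  {within `[a, b], continuous (fun T : R => 1 / (1 - T ^+ 2))}.
Proof.
move=> a1 b1; apply: continuous_in_subspaceT => T; rewrite inE/= in_itv/= => /andP[aT Tb].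
by apply: continuous_inv_one_minus_sqr; rewrite (lt_le_trans a1)//= (le_lt_trans Tb).
Qed.

Lemma integral_inv_one_minus_sqr (a b : R) : -1 < a -> a < b -> b < 1 ->
  \int[mu]_(T in `[a, b]) (1 / (1 - T ^+ 2)) =
  1 / 2 * ln (((1 - a) * (1 + b)) / ((1 + a) * (1 - b))).
Proof.
move=> a1 ab b1.
(* The primitive is artanh. *)
pose G (x : R) : R := 2^-1 * (ln (1 + x) - ln (1 - x)).
have dG (x : R) : -1 < x < 1 -> is_derive x 1 G (1 / (1 - x ^+ 2)).
  move=> /andP[x1 x2].
  have p1 : 0 < 1 + x by lra.
  have p2 : 0 < 1 - x by lra.
  have i1 : is_derive x 1 (fun y : R => 1 + y) (0 + 1) by exact: is_deriveD.
  have i2 : is_derive x 1 (fun y : R => 1 - y) (0 - 1) by exact: is_deriveB.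
  have d1 := @is_derive1_comp _ (@ln R) (fun y => 1 + y) x _ _ (is_derive1_ln p1) i1.
  have d2 := @is_derive1_comp _ (@ln R) (fun y => 1 - y) x _ _ (is_derive1_ln p2) i2.
  apply: (trigger_derive (is_deriveZ 2^-1 (is_deriveB d1 d2))).
  rewrite /GRing.scale/=.
  have p3 : 0 < 1 - x ^+ 2 by nra.
  by field; rewrite (gt_eqF p1) (gt_eqF p2) (gt_eqF p3).
have cG (x : R) : -1 < x < 1 -> {for x, continuous G}.
  move=> /dG dx; apply: differentiable_continuous; apply/derivable1_diffP.
  exact: ex_derive.
rewrite /Rintegral (@continuous_FTC2 _ _ G) //.
- have a2 : 0 < 1 + a by lra.
  have a3 : 0 < 1 - a by lra.
  have b2 : 0 < 1 + b by lra.
  have b3 : 0 < 1 - b by lra.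
  by rewrite /= /G ln_div ?posrE ?mulr_gt0// !lnM ?posrE//; field.
- exact: within_continuous_inv_one_minus_sqr.
- split.
  + move=> x; rewrite in_itv/= => /andP[ax xb]; apply: ex_derive; apply: dG.
    by rewrite (lt_trans a1 ax) (lt_trans xb b1).
  + by apply: cvg_at_right_filter; apply: cG; rewrite a1 (lt_trans ab).
  + by apply: cvg_at_left_filter; apply: cG; rewrite b1 (lt_trans a1).
- move=> x; rewrite in_itv/= => /andP[ax xb].
  have h : is_derive x 1 G (1 / (1 - x ^+ 2)).
    by apply: dG; rewrite (lt_trans a1 ax) (lt_trans xb b1).
  by rewrite derive1E derive_val.
Qed.

Lemma expected_zerosS N (u v : R) :
  (forall T : R, -1 <= T <= 1 -> Omega_mean (fun a : coeffs R N => `|(monic_poly a).[T]|) =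
     (2 / odd_cbin R N./2 * density N T)%:E) ->
  -1 < u -> u <= v -> v < 1 ->
  (expected_zeros N.+1 u v = \int[mu]_(T in `[u, v]) (density N T)%:E)%E.
Proof.
move=> mean u1 uv v1; have [V V0 VE] := Omega_volume_fin N.
have o0 := odd_cbin_gt0 R N./2; set k := 2 / odd_cbin R N./2 in mean.
have k0 : 0 < k by rewrite divr_gt0.
rewrite /expected_zeros {1}/Omega_mean zeros_identity// Omega_volumeS VE -/(odd_cbin R _) -/k.
rewrite -EFinM inver (gt_eqF (mulr_gt0 k0 V0)) -ge0_integralZl//=; last 3 first.
- exact: (measurable_funTS (measurable_mean_horner (R := R) N)).
- by move=> T _; apply: integral_ge0 => q _; rewrite lee_fin.
- by rewrite lee_fin invr_ge0 mulr_ge0 ?ltW.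
apply: eq_integral => T; rewrite inE/= in_itv/= => /andP[uT Tv].
have T1 : -1 <= T <= 1 by rewrite (le_trans (ltW u1) uT) (le_trans Tv (ltW v1)).
have := mean T T1; rewrite /Omega_mean VE inver gt_eqF// => h.
have -> : (((k * V)^-1)%:E = (k^-1)%:E * (V^-1)%:E)%E by rewrite invfM EFinM.
by rewrite -muleA h -EFinM mulKf// gt_eqF.
Qed.

End expectation.

(** * Passage to the limit under the integral *)

Section limit.
Variable R : realType.
Local Notation mu := (@lebesgue_measure R).

Lemma measurable_density n (A : set R) : measurable_fun A (density n : R -> R).
Proof.
apply: measurable_funTS; rewrite /density /weighted_sum.
apply: measurable_funM; first exact: measurable_cst.
have h (s : nat -> R) m : measurable_fun [set: R] (fun T : R =>
    \sum_(0 <= k < m.+1) s (m - k)%N / s m * (cbin R k * (T ^+ 2) ^+ k)).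
  apply: measurable_sum => k; apply: measurable_funM; first exact: measurable_cst.
  apply: measurable_funM; first exact: measurable_cst.
  by apply: measurable_funX; exact: exprn_measurable.
by apply: measurable_funM; exact: h.
Qed.

Lemma integral_density_cvg (a b : R) : -1 < a -> a < b -> b < 1 ->
  (\int[mu]_(T in `[a, b]) (density n T)%:E @[n --> \oo] -->
   \int[mu]_(T in `[a, b]) ((pi * (1 - T ^+ 2))^-1)%:E)%E.
Proof.
(* The interval stays within |T| <= r < 1, where the densities have a common constant bound. *)
move=> a1 ab b1; pose r := Num.max `|a| `|b|.
have r01 : 0 <= r < 1.
  by rewrite le_max normr_ge0/= gt_max !ltr_norml a1 b1 (lt_trans ab) ?(lt_trans a1).
pose C := 2 * (2 / (1 - r ^+ 2) ^+ 2) ^+ 2.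
apply: (@dominated_cvg _ _ _ mu _ (measurable_itv _)
  (fun n T => (density n T)%:E) _ (cst C%:E)).
- by move=> n; apply/measurable_EFinP; exact: measurable_density.
- move=> T; rewrite /= in_itv/= => /andP[aT Tb]; apply: cvg_EFin; first exact: nearW.
  by apply: cvg_density; rewrite (lt_le_trans a1)// (le_lt_trans Tb).
- by [].
- by apply: (@integrable_continuous_itv R (cst C)) => x; exact: cvg_cst.
- move=> n T; rewrite /= in_itv/= => /andP[aT Tb]; rewrite lee_fin; apply: density_bound => //.
  rewrite ler_norml lerNl !le_max; apply/andP; split; apply/orP; [left|right].
    by rewrite (@le_trans _ _ (- a)) ?lerN2// -normrN ler_norm.
  by rewrite (le_trans Tb)// ler_norm.
Qed.

Lemma integrable_inv_one_minus_sqr (a b : R) : -1 < a -> b < 1 ->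
  mu.-integrable `[a, b] (EFin \o (fun T : R => 1 / (1 - T ^+ 2))).
Proof.
move=> a1 b1; apply: continuous_compact_integrable; first exact: segment_compact.
exact: within_continuous_inv_one_minus_sqr.
Qed.

End limit.

Theorem theorem1p16 (R : realType)
  (mean_even : forall (m : nat) (T : R), -1 <= T <= 1 ->
    Omega_mean (fun a : coeffs R (2 * m) => `|(monic_poly a).[T]|) =
    (1 / (2 ^+ (2 * m) * 'C(2 * m, m)%:R)
     * (\sum_(0 <= k < m.+1)
          (2 * m - 2 * k + 1)%:R / (2 * m + 1)%:R
          * 'C(2 * m - 2 * k, m - k)%:R * 'C(2 * k, k)%:R * T ^+ (2 * k))
     * (\sum_(0 <= k < m.+1)
          'C(2 * m - 2 * k, m - k)%:R * 'C(2 * k, k)%:R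
          * T ^+ (2 * k)))%:E)
  (mean_odd : forall (m : nat) (T : R), -1 <= T <= 1 ->
    Omega_mean (fun a : coeffs R (2 * m + 1) => `|(monic_poly a).[T]|) =
    (1 / (2 ^+ (2 * m + 2) * 'C(2 * m, m)%:R)
     * (\sum_(0 <= k < m.+1)
          (2 * m - 2 * k + 1)%:R / (2 * m + 1)%:R
          * 'C(2 * m - 2 * k, m - k)%:R * 'C(2 * k, k)%:R * T ^+ (2 * k))
     * (\sum_(0 <= k < m.+2)
          'C(2 * m + 2 - 2 * k, m + 1 - k)%:R * 'C(2 * k, k)%:R
          * T ^+ (2 * k)))%:E)
  (a b : R) (a_gtN1 : -1 < a) (a_lt_b : a < b) (b_lt1 : b < 1) :
  expected_zeros N a b @[N --> \oo] -->
    (1 / pi * \int[lebesgue_measure]_(T in `[a, b]) (1 / (1 - T ^+ 2)))%:E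
  /\
  1 / pi * \int[lebesgue_measure]_(T in `[a, b]) (1 / (1 - T ^+ 2)) =
    1 / (2 * pi) * ln `|((1 - a) * (1 + b)) / ((1 + a) * (1 - b))|.
Proof.
have mean N (T : R) : -1 <= T <= 1 ->
    Omega_mean (fun a : coeffs R N => `|(monic_poly a).[T]|) =
    (2 / odd_cbin R N./2 * density N T)%:E.
  move=> T1; have [m [->|->]] : exists m, N = (2 * m)%N \/ N = (2 * m + 1)%N.
    by exists N./2; have := odd_double_half N; lia.
  - have -> : ((2 * m)./2 = m)%N by lia.
    by rewrite -density_even; exact: mean_even.
  - have -> : ((2 * m + 1)./2 = m)%N by lia.
    by rewrite -density_odd; exact: mean_odd.
have I := integral_inv_one_minus_sqr a_gtN1 a_lt_b b_lt1.
have p0 := pi_gt0 R.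
split; last first.
  rewrite I ger0_norm; last first.
    by rewrite divr_ge0 ?mulr_ge0//; lra.
  by move: (ln _) => L; move: (pi : R) p0 => p p0; field; rewrite gt_eqF.
have iI := integrable_inv_one_minus_sqr a_gtN1 b_lt1.
have -> : (1 / pi * \int[lebesgue_measure]_(T in `[a, b]) (1 / (1 - T ^+ 2)))%:E =
    (\int[lebesgue_measure]_(T in `[a, b]) ((pi * (1 - T ^+ 2))^-1)%:E)%E.
  rewrite -RintegralZl// /Rintegral fineK; last first.
    under eq_integral do rewrite EFinM.
    by rewrite integralZl// fin_numM// integrable_fin_num.
  by under eq_integral do rewrite !mul1r -invfM.
(* Splitting off a zero lowers the degree by one, so the sequence is taken from degree 1 on. *)
rewrite -cvg_shiftS.
have -> : [sequence expected_zeros n.+1 a b]_n =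
    (fun n => \int[lebesgue_measure]_(T in `[a, b]) (density n T)%:E)%E.
  by apply/funext => n; apply: expected_zerosS => //; [exact: mean|exact: ltW].
exact: integral_density_cvg.
Qed.
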